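(* The Kleisli category $\mathrm{Kl}(\mathsf{P})$ of the monad $\mathsf{P}$ on $\mathbf{SSS}$ is a symmetric monoidal category with $\mathcal{X}\otimes\mathcal{Y}:=\mathcal{X}\times\mathcal{Y}$ on objects and unit the one-point space $\mathbf{1}$, in which every object carries the commutative comonoid $$(\mathrm{copy}_{\mathcal{X}},\ \mathrm{del}_{\mathcal{X}}):=(\delta\circ\Delta_{\mathcal{X}},\ \delta\circ !_{\mathcal{X}}),$$ where $\Delta_{\mathcal{X}}:\mathcal{X}\to\mathcal{X}\times\mathcal{X}$ is the diagonal and $!_{\mathcal{X}}:\mathcal{X}\to\mathbf{1}$, compatibly with the monoidal structure, and in which $\mathbf{1}$ is terminal (equivalently, $\mathrm{del}$ is natural). That is, $\mathrm{Kl}(\mathsf{P})$ is a Markov category, for every object of $\mathbf{SSS}$ and with no further hypothesis. It is not cartesian: $\mathrm{copy}$ is not natural, since for a non-Dirac $\mu\in\mathsf{P}(\mathbb{R})$ one has $\Delta_*\mu\neq\mu\otimes\mu$. However, $\mathrm{copy}$ is natural along every morphism in the image of the functor $\delta_*:\mathbf{SSS}\to\mathrm{Kl}(\mathsf{P})$, $f\mapsto\delta\circ f$, so every such morphism is deterministic.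
   Context: **Sample space.** $\Omega=[0,1]^{\mathbb{N}}$; $\mathcal{B}_\Omega$ is the universal completion of its Borel (product) $\sigma$-algebra, i.e. all universally measurable subsets; $\Omega^\Omega$ is the set of all $\mathcal{B}_\Omega$-$\mathcal{B}_\Omega$-measurable self-maps of $\Omega$; $\mathsf{P}_\Omega$ is the set of all probability measures on $\mathcal{B}_\Omega$; $U=\bigotimes_{n}U[0,1]$ is the uniform measure. $\Theta=(\Theta_1,\Theta_2):\Omega\to\Omega\times\Omega$ is the Borel isomorphism de-interleaving the coordinates of a sequence (e.g. even- and odd-indexed coordinates); $\Theta_*U=U\otimes U$. **Site.** $\Omega_n:=\mathbb{R}^n\times\Omega$, $n\ge0$ ($\Omega_0=\Omega$). A map $g:\Omega_m\to\mathbb{R}^n$ is mixed-smooth, $g\in\mathcal{C}^\infty_{\mathrm{mix}}(\Omega_m,\mathbb{R}^n)$, if (M1) $g(-,\omega)\in C^\infty(\mathbb{R}^m,\mathbb{R}^n)$ for every $\omega$, and (M2) $g(t,-)$ is $\mathcal{B}_\Omega$-Borel measurable for every $t$. The category $\mathbb{S}$ has objects $\Omega_n$ and morphisms $\mathbb{S}(\Omega_m,\Omega_n)=\{(g,\Phi): g\in\mathcal{C}^\infty_{\mathrm{mix}}(\Omega_m,\mathbb{R}^n),\Phi\in\Omega^\Omega\}$, where $(g,\Phi)(t,\omega)=(g(t,\omega),\Phi(\omega))$, composed as maps. **Sample-smooth spaces.** A sample-smooth space is a set $\mathcal{X}$ with, for each $n\ge0$, a set $\mathcal{X}^{\Omega_n}$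 of maps $\Omega_n\to\mathcal{X}$ (plots) containing all constant maps and such that $p\in\mathcal{X}^{\Omega_n}$, $h\in\mathbb{S}(\Omega_m,\Omega_n)$ imply $p\circ h\in\mathcal{X}^{\Omega_m}$. A map $f:\mathcal{X}\to\mathcal{Y}$ is sample-smooth (a morphism of $\mathbf{SSS}$) if $f\circ p\in\mathcal{Y}^{\Omega_n}$ for all $n$ and $p\in\mathcal{X}^{\Omega_n}$. Write $\mathcal{X}^\Omega:=\mathcal{X}^{\Omega_0}$. Products: $(\prod_i\mathcal{X}_i)^{\Omega_n}=\prod_i\mathcal{X}_i^{\Omega_n}$. $\mathbb{R}^k$ carries the plots $\mathcal{C}^\infty_{\mathrm{mix}}(\Omega_n,\mathbb{R}^k)$. The induced $\sigma$-algebra is $\mathcal{B}_{\mathcal{X}}:=\{A\subseteq\mathcal{X}: X^{-1}(A)\in\mathcal{B}_\Omega\ \forall X\in\mathcal{X}^\Omega\}$. **The monad.** $\mathsf{P}(\mathcal{X}):=\{X_*P: X\in\mathcal{X}^\Omega, P\in\mathsf{P}_\Omega\}$, a set of probability measures on $(\mathcal{X},\mathcal{B}_{\mathcal{X}})$, with plots $\mathsf{P}(\mathcal{X})^{\Omega_n}:=\{\mathsf{L}Y: Y\in\mathcal{X}^{\Omega_n}\}$, $\mathsf{L}Y(t,\omega):=(\omega'\mapsto Y(t,\Theta^{-1}(\omega,\omega')))_*U$. $\mathsf{P}(f)(\mu)=f_*\mu$; unit $\delta_{\mathcal{X}}(x)=\delta_x$ (Dirac measure); multiplication $\mathbb{M}_{\mathcal{X}}(\Gamma)=\int\nu\,\Gamma(d\nu)$.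 These form a monad on $\mathbf{SSS}$. For $\mu\in\mathsf{P}(\mathcal{X})$, $\nu\in\mathsf{P}(\mathcal{Y})$ the product $\mu\otimes\nu\in\mathsf{P}(\mathcal{X}\times\mathcal{Y})$ is defined on all of $\mathcal{B}_{\mathcal{X}\times\mathcal{Y}}$ by $(\mu\otimes\nu)(C)=\int\!\int \mathbf{1}[(X(\omega_1),Y(\omega_2))\in C]\,U(d\omega_2)U(d\omega_1)$ for any $X\in\mathcal{X}^\Omega$, $Y\in\mathcal{Y}^\Omega$ with $X_*U=\mu$, $Y_*U=\nu$ (such exist, and the value does not depend on the choice). **Kleisli category.** $\mathrm{Kl}(\mathsf{P})$ has the objects of $\mathbf{SSS}$, morphisms $\mathrm{Kl}(\mathsf{P})(\mathcal{X},\mathcal{Y})=\mathbf{SSS}(\mathcal{X},\mathsf{P}(\mathcal{Y}))$, composition $L\bullet K=\mathbb{M}_{\mathcal{Z}}\circ\mathsf{P}(L)\circ K$ and identities $\delta$. The monoidal product of morphisms $K:\mathcal{X}\to\mathsf{P}(\mathcal{Y})$, $L:\mathcal{Z}\to\mathsf{P}(\mathcal{W})$ is $K\boxtimes L:\ (x,z)\mapsto K(x)\otimes L(z)$. A Markov category (Fritz) is a symmetric monoidal category in which every object carries a commutative comonoid $(\mathrm{copy},\mathrm{del})$ compatible with the monoidal structure and such that $\mathrm{del}$ is natural; a morphism $K:\mathcal{X}\to\mathcal{Y}$ in it is deterministic if $\mathrm{copy}_{\mathcal{Y}}\bullet K=(K\boxtimes K)\bullet\mathrm{copy}_{\mathcal{X}}$.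 *)

(* Defs.v *)
From HB Require Import structures.
From mathcomp Require Import all_boot all_order all_algebra.
From mathcomp Require Import all_classical all_reals all_analysis.
From mathcomp Require Import measurable_realfun.

Set Implicit Arguments.
Unset Strict Implicit.
Unset Printing Implicit Defensive.

Import Order.TTheory GRing.Theory Num.Theory.
Import numFieldNormedType.Exports.

Local Open Scope classical_set_scope.
Local Open Scope ring_scope.

Record category := Category {
  Ob :> Type;
  Arr : Ob -> Ob -> Type;
  idm : forall A, Arr A A;
  cmp : forall A B C, Arr B C -> Arr A B -> Arr A C;
  cmp_idl : forall A B (f : Arr A B), cmp (idm B) f = f;
  cmp_idr : forall A B (f : Arr A B), cmp f (idm A) = f;
  cmpA : forall A B C D (h : Arr C D) (g : Arr B C) (f : Arr A B),
    cmp h (cmp g f) = cmp (cmp h g) f }.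

Arguments Arr {c} A B.
Arguments idm {c} A.
Arguments cmp {c A B C} g f.

Declare Scope cat_scope.
Delimit Scope cat_scope with cat.
Notation "g ∘ f" := (cmp g f) (at level 40, left associativity) : cat_scope.
Local Open Scope cat_scope.

Record functor (C D : category) := Functor {
  fob :> C -> D;
  funmap : forall A B, Arr A B -> Arr (fob A) (fob B);
  fmap_id : forall A, funmap (idm A) = idm (fob A);
  fmap_cmp : forall A B E (g : Arr B E) (f : Arr A B),
    funmap (g ∘ f) = funmap g ∘ funmap f }.

Arguments funmap {C D} _ {A B} _.

(* A monad whose underlying functor has the prescribed object map [T]. *)
Record monad (C : category) (T : C -> C) := Monad {
  tmap : forall A B, Arr A B -> Arr (T A) (T B);
  eta : forall A, Arr A (T A);
  mult : forall A, Arr (T (T A)) (T A);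
  tmap_id : forall A, tmap (idm A) = idm (T A);
  tmap_cmp : forall A B E (g : Arr B E) (f : Arr A B),
    tmap (g ∘ f) = tmap g ∘ tmap f;
  eta_nat : forall A B (f : Arr A B), tmap f ∘ eta A = eta B ∘ f;
  mult_nat : forall A B (f : Arr A B),
    tmap f ∘ mult A = mult B ∘ tmap (tmap f);
  mult_etal : forall A, mult A ∘ eta (T A) = idm (T A);
  mult_etar : forall A, mult A ∘ tmap (eta A) = idm (T A);
  multA : forall A, mult A ∘ tmap (mult A) = mult A ∘ mult (T A) }.

Arguments tmap {C T} _ {A B} _.
Arguments eta {C T} _ A.
Arguments mult {C T} _ A.

Section kleisli.
Context (C : category) (T : C -> C) (M : monad T).

Definition kl_hom (A B : C) := Arr A (T B).

Definition kl_cmp A B E (L : kl_hom B E) (K : kl_hom A B) : kl_hom A E :=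
  mult M E ∘ tmap M L ∘ K.

Fact kl_idl A B (K : kl_hom A B) : kl_cmp (eta M B) K = K.
Proof. by rewrite /kl_cmp mult_etar cmp_idl. Qed.

Fact kl_idr A B (K : kl_hom A B) : kl_cmp K (eta M A) = K.
Proof. by rewrite /kl_cmp -cmpA eta_nat cmpA mult_etal cmp_idl. Qed.

Fact kl_cmpA A B E F (H : kl_hom E F) (L : kl_hom B E) (K : kl_hom A B) :
  kl_cmp H (kl_cmp L K) = kl_cmp (kl_cmp H L) K.
Proof.
rewrite /kl_cmp !tmap_cmp !cmpA multA; congr (_ ∘ _ ∘ _).
by rewrite -!cmpA; congr (_ ∘ _); rewrite mult_nat.
Qed.

Definition kleisli : category := Category kl_idl kl_idr kl_cmpA.

Definition kl_incl_map (A B : C) (f : Arr A B) : @Arr kleisli A B := eta M B ∘ f.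

Fact kl_incl_id (A : C) : kl_incl_map (idm A) = @idm kleisli A.
Proof. by rewrite /kl_incl_map cmp_idr. Qed.

Fact kl_incl_cmp (A B E : C) (g : Arr B E) (f : Arr A B) :
  kl_incl_map (g ∘ f) = kl_incl_map g ∘ kl_incl_map f.
Proof.
rewrite /kl_incl_map /= /kl_cmp tmap_cmp !cmpA mult_etar cmp_idl.
by rewrite eta_nat.
Qed.

Definition kl_incl : functor C kleisli :=
  @Functor C kleisli id kl_incl_map kl_incl_id kl_incl_cmp.

End kleisli.

(* Symmetric monoidal structures on [C] with prescribed tensor of objects
   and unit object. *)
Record sym_monoidal (C : category) (ox : C -> C -> C) (I : C) := SymMonoidal {
  tens : forall A A' B B', Arr A A' -> Arr B B' -> Arr (ox A B) (ox A' B');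
  assoc : forall A B D, Arr (ox (ox A B) D) (ox A (ox B D));
  assocV : forall A B D, Arr (ox A (ox B D)) (ox (ox A B) D);
  lunit : forall A, Arr (ox I A) A;
  lunitV : forall A, Arr A (ox I A);
  runit : forall A, Arr (ox A I) A;
  runitV : forall A, Arr A (ox A I);
  swap : forall A B, Arr (ox A B) (ox B A);
  tens_id : forall A B, tens (idm A) (idm B) = idm (ox A B);
  tens_cmp : forall A A' A'' B B' B'' (g : Arr A' A'') (f : Arr A A')
    (k : Arr B' B'') (h : Arr B B'),
    tens (g ∘ f) (k ∘ h) = tens g k ∘ tens f h;
  assocK : forall A B D, assocV A B D ∘ assoc A B D = idm _;
  assocVK : forall A B D, assoc A B D ∘ assocV A B D = idm _;
  lunitK : forall A, lunitV A ∘ lunit A = idm _;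
  lunitVK : forall A, lunit A ∘ lunitV A = idm _;
  runitK : forall A, runitV A ∘ runit A = idm _;
  runitVK : forall A, runit A ∘ runitV A = idm _;
  assoc_nat : forall A A' B B' D D' (f : Arr A A') (g : Arr B B')
    (h : Arr D D'),
    assoc A' B' D' ∘ tens (tens f g) h = tens f (tens g h) ∘ assoc A B D;
  lunit_nat : forall A A' (f : Arr A A'),
    lunit A' ∘ tens (idm I) f = f ∘ lunit A;
  runit_nat : forall A A' (f : Arr A A'),
    runit A' ∘ tens f (idm I) = f ∘ runit A;
  swap_nat : forall A A' B B' (f : Arr A A') (g : Arr B B'),
    swap A' B' ∘ tens f g = tens g f ∘ swap A B;
  pentagon : forall A B D E,
    tens (idm A) (assoc B D E) ∘ assoc A (ox B D) E
      ∘ tens (assoc A B D) (idm E)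
    = assoc A B (ox D E) ∘ assoc (ox A B) D E;
  triangle : forall A B,
    tens (idm A) (lunit B) ∘ assoc A I B = tens (runit A) (idm B);
  hexagon : forall A B D,
    assoc B D A ∘ swap A (ox B D) ∘ assoc A B D
    = tens (idm B) (swap A D) ∘ assoc B A D ∘ tens (swap A B) (idm D);
  swapK : forall A B, swap B A ∘ swap A B = idm (ox A B) }.

Arguments tens {C ox I} _ {A A' B B'} _ _.
Arguments assoc {C ox I} _ A B D.
Arguments assocV {C ox I} _ A B D.
Arguments lunit {C ox I} _ A.
Arguments lunitV {C ox I} _ A.
Arguments runit {C ox I} _ A.
Arguments runitV {C ox I} _ A.
Arguments swap {C ox I} _ A B.

(* The canonical (A ⊗ B) ⊗ (D ⊗ E) -> (A ⊗ D) ⊗ (B ⊗ E). *)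
Definition interchange (C : category) (ox : C -> C -> C) (I : C)
    (S : sym_monoidal ox I) (A B D E : C) :
    Arr (ox (ox A B) (ox D E)) (ox (ox A D) (ox B E)) :=
  assocV S A D (ox B E)
    ∘ tens S (idm A) (assoc S D B E ∘ tens S (swap S B D) (idm E)
                        ∘ assocV S B D E)
    ∘ assoc S A B (ox D E).

(* Markov categories in the sense of Fritz. *)
Record markov_category (C : category) (ox : C -> C -> C) (I : C) := Markov {
  markov_smc :> sym_monoidal ox I;
  copy : forall A, Arr A (ox A A);
  del : forall A, Arr A I;
  copyA : forall A,
    assoc markov_smc A A A ∘ tens markov_smc (copy A) (idm A) ∘ copy A
    = tens markov_smc (idm A) (copy A) ∘ copy A;
  copy_dell : forall A,
    lunit markov_smc A ∘ tens markov_smc (del A) (idm A) ∘ copy A = idm A;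
  copy_delr : forall A,
    runit markov_smc A ∘ tens markov_smc (idm A) (del A) ∘ copy A = idm A;
  copyC : forall A, swap markov_smc A A ∘ copy A = copy A;
  copy_tens : forall A B,
    copy (ox A B)
    = interchange markov_smc A A B B ∘ tens markov_smc (copy A) (copy B);
  del_tens : forall A B,
    del (ox A B) = lunit markov_smc I ∘ tens markov_smc (del A) (del B);
  copy_unit : copy I = lunitV markov_smc I;
  del_unit : del I = idm I;
  del_nat : forall A B (f : Arr A B), del B ∘ f = del A }.

Arguments copy {C ox I} _ A.
Arguments del {C ox I} _ A.

Definition terminal (C : category) (I : C) : Prop :=
  forall A : C, exists! f : Arr A I, True.

Section markov_notions.
Context (C : category) (ox : C -> C -> C) (I : C) (M : markov_category ox I).

Definition deterministic A B (f : Arr A B) : Prop :=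
  copy M B ∘ f = tens M f f ∘ copy M A.

Definition copy_natural : Prop :=
  forall A B (f : Arr A B), deterministic f.

Definition marginal1 A B : Arr (ox A B) A :=
  runit M A ∘ tens M (idm A) (del M B).

Definition marginal2 A B : Arr (ox A B) B :=
  lunit M B ∘ tens M (del M A) (idm B).

Definition cartesian : Prop :=
  terminal I /\
  forall A B Z (f : Arr Z A) (g : Arr Z B),
    exists! h : Arr Z (ox A B), marginal1 A B ∘ h = f /\ marginal2 A B ∘ h = g.

End markov_notions.

Definition Omega (R : realType) : Type := nat -> {i01 R}.

HB.instance Definition _ (R : realType) := gen_eqMixin (Omega R).
HB.instance Definition _ (R : realType) := gen_choiceMixin (Omega R).
HB.instance Definition _ (R : realType) :=
  isPointed.Build (Omega R) (fun=> 0%:i01).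

Section omega.
Context (R : realType).
Local Notation Omega := (Omega R).

Definition coord_events : set (set Omega) :=
  [set A | exists n (B : set R),
     measurable B /\ A = [set w | B (w n)%:num]].

Definition OmegaBorel : Type := g_sigma_algebraType coord_events.

HB.instance Definition _ := Measurable.on OmegaBorel.

Definition universally_measurable : set (set Omega) :=
  [set A | forall P : probability OmegaBorel R,
     completed_algebra_gen (R := R) (P : set OmegaBorel -> \bar R) A].

Fact um0 : universally_measurable set0.
Proof.
by move=> P; exists set0 => //; exists set0; rewrite ?setU0//; exact: negligible_set0.
Qed.

Fact umC A : universally_measurable A -> universally_measurable (~` A).
Proof.
move=> uA P; have [B mB [N [N' [mN' N'0 NN']] <-]] := uA P.
exists (~` B `&` ~` N'); first by apply: measurableI; exact: measurableC.
exists (~` (B `|` N) `&` N').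
  by exists N'; split => // x [].
apply/seteqP; split => [x [[nB nN']|[]//]|x nBN].
  by case => // /NN'.
have [xN'|nN'] := pselect (N' x); [by right|left].
by split => // Bx; apply: nBN; left.
Qed.

Fact umU (F : (set Omega)^nat) : (forall i, universally_measurable (F i)) ->
  universally_measurable (\bigcup_i F i).
Proof.
move=> uF P; have /choice[B BP] : forall i, exists B : set Omega,
    measurable (B : set OmegaBorel) /\
    exists2 N, P.-negligible N & B `|` N = F i.
  by move=> i; have [B mB [N nN BN]] := uF i P; exists B; split=> //; exists N.
have /choice[N NP] : forall i, exists N,
    P.-negligible (N : set OmegaBorel) /\ B i `|` N = F i.
  by move=> i; have [_ [N nN BN]] := BP i; exists N.
exists (\bigcup_i B i).
  by apply: bigcupT_measurable => i; exact: (BP i).1.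
exists (\bigcup_i N i); first by apply: negligible_bigcup => i; exact: (NP i).1.
by rewrite -bigcupU; apply: eq_bigcupr => i _; exact: (NP i).2.
Qed.

Definition omega_display : measure_display. Proof. by constructor. Qed.

HB.instance Definition _ :=
  @isMeasurable.Build omega_display Omega universally_measurable um0 umC umU.

Definition theta1 (w : Omega) : Omega := fun n => w n.*2.
Definition theta2 (w : Omega) : Omega := fun n => w n.*2.+1.
Definition thetaV (w w' : Omega) : Omega :=
  fun n => if odd n then w' n./2 else w n./2.

(* The product of countably many uniform laws is not in the library; it is
   selected by its finite-dimensional marginals, which determine it on
   the Borel sets, hence on the universally measurable ones. *)
Definition is_uniform (P : probability Omega R) : Prop :=
  forall n (B : nat -> set R), (forall i, measurable (B i)) ->
    P [set w | forall i, (i < n)%N -> B i (w i)%:num]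
    = (\prod_(i < n) uniform_prob (@ltr01 R) (B i))%E.

Definition unif : probability Omega R := 
  xget (\d_(point : Omega) : probability Omega R) is_uniform.

End omega.

Section site.
Context (R : realType).

(* f is C^(k+1) iff it is differentiable with all directional derivatives
   C^k. *)
Fixpoint Ck m n (k : nat) (f : 'rV[R]_m -> 'rV[R]_n) : Prop :=
  if k is k'.+1 then
    (forall t, differentiable f t) /\ (forall v, Ck k' (fun t => 'D_v f t))
  else continuous f.

Definition Cinfty m n (f : 'rV[R]_m -> 'rV[R]_n) : Prop := forall k, Ck k f.

Definition Omega_ (n : nat) : Type := ('rV[R]_n * Omega R)%type.

Definition mixed_smooth m n (g : Omega_ m -> 'rV[R]_n) : Prop :=
  (forall w, Cinfty (fun t => g (t, w))) /\
  (forall t, measurable_fun setT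
    ((fun w => g (t, w)) : Omega R -> g_sigma_algebraType (@open 'rV[R]_n))).

Definition site_hom m n : set (Omega_ m -> Omega_ n) :=
  [set h | exists (g : Omega_ m -> 'rV[R]_n) (Phi : Omega R -> Omega R),
    [/\ mixed_smooth g, measurable_fun setT Phi
      & h = fun x => (g x, Phi x.2)]].

End site.

Arguments site_hom {R} m n _.

(* A set with families of plots, the two closure axioms being stated apart. *)
Record plot_space (R : realType) := PlotSpace {
  pts :> Type;
  plots : forall n, set (Omega_ R n -> pts) }.

Arguments plots {R} _ n _.

Definition sample_smooth (R : realType) (X : plot_space R) : Prop :=
  (forall n (x : X), plots X n (fun=> x)) /\
  (forall m n (p : Omega_ R n -> X) (h : Omega_ R m -> Omega_ R n),
    plots X n p -> site_hom m n h -> plots X m (p \o h)).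

Record sss (R : realType) := SSS {
  sss_plots :> plot_space R;
  sssP : sample_smooth sss_plots }.

Definition is_smooth (R : realType) (X Y : plot_space R) (f : X -> Y) : Prop :=
  forall n (p : Omega_ R n -> X), plots X n p -> plots Y n (f \o p).

Section sss_category.
Context (R : realType).

Definition smap (X Y : plot_space R) : Type := {f : X -> Y | is_smooth f}.

Definition smap_id (X : plot_space R) : smap X X :=
  exist (@is_smooth R X X) id (fun _ _ => id).

Definition smap_cmp (X Y Z : plot_space R) (g : smap Y Z) (f : smap X Y) :
    smap X Z :=
  exist (@is_smooth R X Z) (sval g \o sval f)
    (fun n p pp => proj2_sig g _ _ (proj2_sig f _ _ pp)).

Fact smap_eq (X Y : plot_space R) (f g : smap X Y) : sval f = sval g -> f = g.
Proof.
case: f g => [f sf] [g sg] /= fg; rewrite -{}fg in sg *.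
by congr exist; exact: Prop_irrelevance.
Qed.

Fact smap_idl (X Y : sss R) (f : smap X Y) : smap_cmp (smap_id Y) f = f.
Proof. exact: smap_eq. Qed.

Fact smap_idr (X Y : sss R) (f : smap X Y) : smap_cmp f (smap_id X) = f.
Proof. exact: smap_eq. Qed.

Fact smap_cmpA (X Y Z W : sss R) (h : smap Z W) (g : smap Y Z) (f : smap X Y) :
  smap_cmp h (smap_cmp g f) = smap_cmp (smap_cmp h g) f.
Proof. exact: smap_eq. Qed.

Definition SSScat : category :=
  @Category (sss R) smap (fun X => smap_id X) (fun X Y Z => @smap_cmp X Y Z)
    smap_idl smap_idr smap_cmpA.

Definition euclidean (k : nat) : plot_space R :=
  @PlotSpace R 'rV[R]_k (fun n => [set p | @mixed_smooth R n k p]).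

Definition one_space : plot_space R := @PlotSpace R unit (fun=> setT).

Fact one_sss : sample_smooth one_space. Proof. by []. Qed.

Definition one_obj : SSScat := SSS one_sss.

Definition prod_space (X Y : plot_space R) : plot_space R :=
  @PlotSpace R (X * Y)%type
    (fun n => [set p | plots X n (fst \o p) /\ plots Y n (snd \o p)]).

Fact prod_sss (X Y : sss R) : sample_smooth (prod_space X Y).
Proof.
have [X1 X2] := sssP X; have [Y1 Y2] := sssP Y; split=> [n [x y]|m n p h].
  by split; [exact: X1|exact: Y1].
by move=> [p1 p2] hh; split; [exact: (X2 _ _ _ _ p1)|exact: (Y2 _ _ _ _ p2)].
Qed.

Definition prod_obj (X Y : SSScat) : SSScat := SSS (@prod_sss X Y).

Definition diag (X : SSScat) : Arr X (prod_obj X X) :=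
  exist (@is_smooth R X (prod_space X X)) (fun x => (x, x))
    (fun _ _ pp => conj pp pp).

Definition bang (X : SSScat) : Arr X one_obj :=
  exist (@is_smooth R X one_space) (fun=> tt) (fun _ _ _ => Logic.I).

Definition proj1_map (X Y : SSScat) : Arr (prod_obj X Y) X :=
  exist (@is_smooth R (prod_space X Y) X) fst (fun _ _ pp => proj1 pp).

Definition proj2_map (X Y : SSScat) : Arr (prod_obj X Y) Y :=
  exist (@is_smooth R (prod_space X Y) Y) snd (fun _ _ pp => proj2 pp).

Definition swap_map (X Y : SSScat) : Arr (prod_obj X Y) (prod_obj Y X) :=
  exist (@is_smooth R (prod_space X Y) (prod_space Y X))
    (fun a => (a.2, a.1)) (fun _ _ pp => conj (proj2 pp) (proj1 pp)).

Definition assoc_map (X Y Z : SSScat) :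
    Arr (prod_obj (prod_obj X Y) Z) (prod_obj X (prod_obj Y Z)) :=
  exist (@is_smooth R (prod_space (prod_space X Y) Z)
           (prod_space X (prod_space Y Z)))
    (fun a => (a.1.1, (a.1.2, a.2)))
    (fun _ _ pp => conj (proj1 (proj1 pp)) (conj (proj2 (proj1 pp)) (proj2 pp))).

End sss_category.

Section prob.
Context (R : realType).
Implicit Types X Y : plot_space R.

Definition samples X : set (Omega R -> X) :=
  [set x | plots X 0 (fun a => x a.2)].

Definition induced_sigma X : set (set X) :=
  [set A | forall x, samples x -> measurable (x @^-1` A)].

(* A measure on (X, induced_sigma X) is coded as a set function that vanishes
   off induced_sigma X, so that Leibniz equality of codes is equality of
   measures. *)
Definition pushm X Y (f : X -> Y) (mu : set X -> \bar R) : set Y -> \bar R :=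
  (fun A => mu (f @^-1` A)) \_ (@induced_sigma Y).

Definition law (P : set (Omega R) -> \bar R) X (x : Omega R -> X) :
    set X -> \bar R :=
  (fun A => P (x @^-1` A)) \_ (@induced_sigma X).

Definition dirac_law X (x : X) : set X -> \bar R :=
  (fun A => (\1_A x)%:E) \_ (@induced_sigma X).

Definition is_prob X (mu : set X -> \bar R) : Prop :=
  exists (x : Omega R -> X) (P : probability (Omega R) R),
    samples x /\ mu = law P x.

Definition Prob X : plot_space R :=
  @PlotSpace R {mu : set X -> \bar R | is_prob mu}
    (fun n => [set p | exists2 Y : Omega_ R n -> X, plots X n Y
       & forall t w, sval (p (t, w)) = law (unif R) (fun w' => Y (t, thetaV w w'))]).

(* Measurable types of the library are pointed, whereas a sample-smooth space
   may be empty: the point is an extra parameter, and the integral over an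
   empty space is 0. *)
Definition sigma_space X (x0 : X) : Type := X.

Section sigma_space.
Context X (x0 : X).

HB.instance Definition _ := gen_eqMixin (sigma_space x0).
HB.instance Definition _ := gen_choiceMixin (sigma_space x0).
HB.instance Definition _ := isPointed.Build (sigma_space x0) x0.

Fact induced_sigma0 : @induced_sigma X set0.
Proof. by move=> x _; rewrite preimage_set0. Qed.

Fact induced_sigmaC (A : set X) : induced_sigma A -> induced_sigma (~` A).
Proof. by move=> mA x sx; rewrite preimage_setC; exact/measurableC/mA. Qed.

Fact induced_sigmaU (F : (set X)^nat) :
  (forall i, induced_sigma (F i)) -> induced_sigma (\bigcup_i F i).
Proof.
move=> mF x sx; rewrite preimage_bigcup.
by apply: bigcupT_measurable => i; exact: mF.
Qed.

Definition sigma_space_display : measure_display. Proof. by constructor. Qed.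

HB.instance Definition _ := @isMeasurable.Build sigma_space_display
  (sigma_space x0) (@induced_sigma X)
  induced_sigma0 induced_sigmaC induced_sigmaU.

End sigma_space.

Definition integral_on X (mu : set X -> \bar R) (f : X -> \bar R) : \bar R :=
  if pselect (exists x : X, True) is left h then
    (\int[mu : set (sigma_space (sval (cid h))) -> \bar R]_x f x)%E
  else 0%E.

Definition barycenter X (Gamma : set (Prob X) -> \bar R) : set X -> \bar R :=
  (fun A => integral_on Gamma (fun nu => sval nu A)) \_ (@induced_sigma X).

Definition indep_law X Y (x : Omega R -> X) (y : Omega R -> Y) :
    set (prod_space X Y) -> \bar R :=
  (fun C => \int[unif R]_w1 \int[unif R]_w2 (\1_C (x w1, y w2))%:E)%E
    \_ (@induced_sigma (prod_space X Y)).

(* [indep_law x y] depends only on the laws of [x] and [y]; when [mu] or [nu]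
   has no sampler under [unif] (in particular when it is not in [Prob]) the
   value is the zero function. *)
Definition prod_law X Y (mu : set X -> \bar R) (nu : set Y -> \bar R) :
    set (prod_space X Y) -> \bar R :=
  xget (fun=> 0%E) [set pi | exists (x : Omega R -> X) (y : Omega R -> Y),
    [/\ samples x, samples y, law (unif R) x = mu, law (unif R) y = nu
      & pi = indep_law x y]].

End prob.

(* Main.v *)
From HB Require Import structures.
Require Import Defs.
From mathcomp Require Import all_boot all_order all_algebra.
From mathcomp Require Import all_classical all_reals all_analysis.
From mathcomp Require Import measurable_realfun lra.

(** Every law on a sample-smooth space is the law of a sample under the
    uniform measure [unif], so each statement about [Prob] becomes a statement
    about plots and about regrouping an infinite sequence of independent
    uniform variables.  Three facts about sequences carry this.

    Simulation.  [unif] exists, and every probability on the universally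
    measurable sets is the image of [unif] under a universally measurable map
    ([is_uniform_exists], [um_sampler]).  A sequence is coded by one real
    through its digits ([encodeK]), that real is simulated from one uniform
    variable by its quantile function ([quantile_law]), and the code is read
    back.  The same device splits one uniform variable into two independent
    ones, and iterating it produces the infinite product.  Hence constant maps
    are plots of [Prob X] ([Prob_sss], [Prob_unif]).

    Fubini.  For a universally measurable [A], the probability of the section
    of [A] under [thetaV w] is a universally measurable function of [w] whose
    integral is the probability of [A] ([measurable_unif_section],
    [unif_fubini]): against any law of [w], the set [A] agrees with a Borel set
    up to a null set, almost all of whose sections are null.  Consequently, if
    [G w] is the conditional law of a sample [x] given the first half [w] of
    the randomness, the barycenter of the law of [G] is the law of [x]
    ([barycenter_law]), and the product of the laws of [x] and [y] is the law
    of the pair that feeds the two halves to [x] and [y] ([prod_law_unif]).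

    Rearrangement.  Reindexing a sequence along an injection of the indices
    preserves [unif] ([unif_reindex]), so regrouping the streams of randomness
    changes no law ([law_rearrange]).

    With these, both sides of each monad law, of the interchange law for the
    tensor product and of each naturality square are laws of one sample, read
    off from differently grouped randomness.  The coherence and comonoid
    equations involve only images of maps of spaces, on which the tensor
    product is the product of maps ([tens_pure]), and hold pointwise.

    If copying were natural at a constant morphism with value [mu], the image
    of [mu] under the diagonal would be the product of [mu] with itself.
    Evaluating both on [A * A] makes each [mu A] idempotent, hence zero or one;
    the distribution function of [mu] then jumps once, and [mu] is a Dirac
    measure ([zero_one_dirac]), unlike the uniform law.  In a cartesian Markov
    category copying is natural ([cartesian_copy_natural]), so the category is
    not cartesian.

    That the real line is a sample-smooth space at all needs the chain rule for
    iterated directional derivatives ([Ck_comp]) and the joint measurability of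
    functions that are continuous in one argument and measurable in the other
    ([measurable_caratheodory]). *)

Set Implicit Arguments.
Unset Strict Implicit.
Unset Printing Implicit Defensive.

Import Order.TTheory GRing.Theory Num.Theory.
Import numFieldNormedType.Exports.

Local Open Scope classical_set_scope.
Local Open Scope ring_scope.
Local Open Scope cat_scope.

(** * Borel and universally measurable sets of sequences *)

Lemma measure_sandwich d (T : measurableType d) (R : realType)
    (m : {measure set T -> \bar R}) (A B N : set T) :
  measurable A -> measurable B -> measurable N -> m N = 0%E ->
  B `<=` A -> A `<=` B `|` N -> m A = m B.
Proof.
move=> mA mB mN N0 BA ABN; apply/eqP; rewrite eq_le; apply/andP; split.
  rewrite (@le_trans _ _ (m (B `|` N)))//.
    by apply: le_measure; rewrite ?inE//; exact: measurableU.
  by rewrite (le_trans (measureU2 _ _ _))// [X in (_ + X)%E]N0 adde0.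
by apply: le_measure; rewrite ?inE.
Qed.

Section universally_measurable_sets.
Context (R : realType).
Local Notation Om := (Omega R).
Local Notation OB := (OmegaBorel R).

Lemma umP (A : set Om) : measurable A <-> universally_measurable A.
Proof. by []. Qed.

Lemma borel_um (A : set OB) : measurable A -> measurable (A : set Om).
Proof.
move=> mA; apply/umP => P; exists A => //; exists set0; first exact: negligible_set0.
by rewrite setU0.
Qed.

Lemma measurable_to_borel d (T : measurableType d) (f : T -> OB) :
  (forall n, measurable_fun setT (fun x => (f x n)%:num)) ->
  measurable_fun setT f.
Proof.
move=> mf; refine (@measurability _ _ T OB setT f (@coord_events R) erefl _).
move=> _ [_ [n [B [mB ->]]] <-].
exact: (mf n measurableT B mB).
Qed.

Lemma measurable_coord n : measurable_fun setT (fun w : OB => (w n)%:num).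
Proof.
by move=> _ B mB; rewrite setTI; apply: sub_sigma_algebra; exists n, B.
Qed.

Lemma measurable_um_borel : measurable_fun setT (id : Om -> OB).
Proof. by move=> _ B mB; rewrite setTI; exact: borel_um. Qed.

Lemma measurable_coord_um n : measurable_fun setT (fun w : Om => (w n)%:num).
Proof. exact: (measurableT_comp (measurable_coord n) measurable_um_borel). Qed.

(** This makes the outer measure of a Borel probability its extension to the
    universally measurable sets. *)
Lemma um_caratheodory (P : probability OB R) (A : set Om) :
  measurable A -> ((P^*)%mu).-cara.-measurable A.
Proof.
move=> /umP/(_ P)[B mB [N [N' [mN' N'0 NN']] <-]].
apply: (@measurableU _ (caratheodory_type (P^*)%mu)).
  exact: caratheodory_measurable_mu_ext.
apply: measure_is_complete_caratheodory; exists N'; split=> //.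
  exact: caratheodory_measurable_mu_ext.
by rewrite /= measurable_mu_extE.
Qed.

Definition um_ext (P : probability OB R) : set Om -> \bar R := (P^*)%mu.

Section um_ext.
Variable P : probability OB R.

Let um_ext0 : um_ext P set0 = 0%E. Proof. exact: mu_ext0. Qed.

Let um_ext_ge0 A : (0 <= um_ext P A)%E. Proof. exact: mu_ext_ge0. Qed.

Let um_ext_additive : semi_sigma_additive (um_ext P).
Proof.
move=> F mF tF mUF; apply: (@caratheodory_measure_sigma_additive _ _ (P^*)%mu).
- by move=> i; exact: um_caratheodory.
- exact: tF.
- exact: um_caratheodory.
Qed.

HB.instance Definition _ := isMeasure.Build _ _ _ (um_ext P)
  um_ext0 um_ext_ge0 um_ext_additive.

Lemma um_extE (A : set OB) : measurable A -> um_ext P A = P A.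
Proof. by move=> mA; rewrite /um_ext measurable_mu_extE. Qed.

Let um_ext_setT : um_ext P setT = 1%E.
Proof. by rewrite um_extE ?probability_setT//. Qed.

HB.instance Definition _ := Measure_isProbability.Build _ _ _ (um_ext P)
  um_ext_setT.

End um_ext.

(** A copy of [Q] that carries the structure of a measure on the Borel sets. *)
Definition borel_part (Q : probability Om R) : set OB -> \bar R := Q.

Section borel_part.
Variable Q : probability Om R.

Let borel_part0 : borel_part Q set0 = 0%E. Proof. exact: measure0. Qed.

Let borel_part_ge0 A : (0 <= borel_part Q A)%E. Proof. exact: measure_ge0. Qed.

Let borel_part_additive : semi_sigma_additive (borel_part Q).
Proof.
move=> F mF tF mUF; apply: (@measure_semi_sigma_additive _ Om R Q) => //.
  by move=> i; exact: borel_um.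
exact: borel_um.
Qed.

HB.instance Definition _ := isMeasure.Build _ _ _ (borel_part Q)
  borel_part0 borel_part_ge0 borel_part_additive.

Let borel_part_setT : borel_part Q setT = 1%E.
Proof. exact: probability_setT. Qed.

HB.instance Definition _ := Measure_isProbability.Build _ _ _ (borel_part Q)
  borel_part_setT.

End borel_part.

Lemma um_sandwich (Q : probability Om R) (A : set Om) : measurable A ->
  exists B N : set OB, [/\ measurable B, measurable N, Q N = 0%E,
    B `<=` A & A `<=` B `|` N].
Proof.
move=> /umP/(_ (borel_part Q))[B mB [N [N' [mN' N'0 NN']] <-]].
by exists B, N'; split=> //; exact: setUS.
Qed.

Lemma um_null (Q : probability Om R) (A : set Om) : measurable A ->
  Q A = 0%E -> exists N : set OB, [/\ measurable N, Q N = 0%E & A `<=` N].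
Proof.
move=> mA QA0; have [B [N [mB mN QN0 BA ABN]]] := um_sandwich Q mA.
exists (B `|` N); split=> //; first exact: measurableU.
apply/eqP; rewrite eq_le measure_ge0 andbT (le_trans (measureU2 _ _ _))//.
- exact: borel_um.
- exact: borel_um.
- by rewrite [X in (_ + X)%E]QN0 adde0 -QA0 le_measure// inE//; exact: borel_um.
Qed.

(** The approximating set [B] and the exceptional set [N] may depend on the
    probability: universal measurability is tested one probability at a time. *)
Lemma um_ae (A : set Om) :
  (forall Q : probability Om R, exists B N : set Om, [/\ measurable B,
     measurable N, Q N = 0%E & forall w, ~ N w -> (A w <-> B w)]) ->
  measurable A.
Proof.
move=> A_ae; apply/umP => P; have [B [N [mB mN N0 ABN]]] := A_ae (um_ext P).
have [N1 [mN1 N10 NN1]] := um_null mN N0.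
have [B0 mB0 [M [M' [mM' M'0 MM']] B0M]] := (umP B).1 mB P.
exists (B0 `\` N1); first exact: measurableD.
exists (A `&` (N1 `|` M')).
  exists (N1 `|` M'); split; [exact: measurableU| |by move=> w []].
  apply/eqP; rewrite eq_le measure_ge0 andbT (le_trans (measureU2 _ _ _))//.
  have PN1 : P N1 = 0%E by rewrite -um_extE.
  by rewrite [X in (_ + X)%E]M'0 adde0 [X in (X <= _)%E]PN1.
apply/seteqP; split=> [w [[B0w nN1]|[]//]|w Aw].
  by apply/(ABN w (fun Nw => nN1 (NN1 w Nw))); rewrite -B0M; left.
have [N1w|nN1w] := pselect (N1 w); first by right; split=> //; left.
have /(ABN w (fun Nw => nN1w (NN1 w Nw))) := Aw; rewrite -B0M => -[B0w|Mw].
  by left.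
by right; split=> //; right; exact: MM'.
Qed.

(** Against a law [Q], the preimage of a universally measurable set agrees with
    the preimage of a Borel set off the preimage of a Borel set that is null
    for the image of [Q]. *)
Lemma measurable_to_um (f : Om -> Om) :
  measurable_fun setT (f : Om -> OB) -> measurable_fun setT f.
Proof.
move=> mf _ A mA; rewrite setTI; apply: um_ae => Q.
pose F : {mfun Om >-> OB} := mfun_Sub (mem_set mf).
have [B [N [mB mN N0 BA ABN]]] := um_sandwich (um_ext (distribution Q F)) mA.
exists (f @^-1` B), (f @^-1` N); split.
- by rewrite -[X in measurable X]setTI; exact: (mf measurableT).
- by rewrite -[X in measurable X]setTI; exact: (mf measurableT).
- by rewrite -N0 [RHS]um_extE.
- by move=> w nN; split=> [/ABN[]|/BA].
Qed.

(** The extension of a Borel probability to the universally measurable sets is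
    unique, since each such set lies between Borel sets of equal measure. *)
Lemma um_probability_eq (Q1 Q2 : probability Om R) :
  (forall B : set OB, measurable B -> Q1 B = Q2 B) ->
  forall A : set Om, measurable A -> Q1 A = Q2 A.
Proof.
move=> Q12 A mA; have [B [N [mB mN N0 BA ABN]]] := um_sandwich Q1 mA.
have mBu := borel_um mB; have mNu := borel_um mN.
have Q2N : Q2 N = 0%E by rewrite -Q12.
rewrite (measure_sandwich mA mBu mNu N0 BA ABN).
by rewrite (measure_sandwich mA mBu mNu Q2N BA ABN); exact: Q12.
Qed.

End universally_measurable_sets.

(** * Encoding a sequence by one real number *)

Section digits.
Context (R : realType).
Implicit Types (b x : R) (c : nat -> bool) (k M : nat).

(** The sum of [(b - 1) c_k / b^(k+1)] over [k < M]: digits are [0] or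
    [b - 1], so that [b = 2] is binary expansion and [b = 3] the Cantor set. *)
Fixpoint digit_sum b M c : R :=
  if M is M'.+1 then
    ((b - 1) * (c 0%N)%:R + digit_sum b M' (fun k => c k.+1)) / b
  else 0.

Definition of_digits b c : R := limn (fun M => digit_sum b M c).

Definition leading_digit x : bool := 2^-1 <= x.

(** The threshold [1/2] serves both bases: in base three a leading digit [2]
    gives a number at least [2/3], a leading digit [0] one at most [1/3]. *)
Definition digit_shift b x : R := b * x - (b - 1) * (leading_digit x)%:R.

Definition digit b x k : bool := leading_digit (iter k (digit_shift b) x).

Lemma digitS b x k : digit b x k.+1 = digit b (digit_shift b x) k.
Proof. by rewrite /digit iterSr. Qed.

Lemma digit_sum_itv b M c : 1 < b -> 0 <= digit_sum b M c <= 1.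
Proof.
move=> b1; have b0 : 0 < b by lra.
elim: M c => [|M IH] c /=; first by rewrite lexx ler01.
have /andP[s0 s1] := IH (fun k => c k.+1).
rewrite ler_pdivlMr// ler_pdivrMr// mul0r mul1r.
by case: (c 0%N); rewrite ?mulr1 ?mulr0; apply/andP; split; lra.
Qed.

Lemma digit_sum_nondecreasing b c : 1 < b ->
  nondecreasing_seq (fun M => digit_sum b M c).
Proof.
move=> b1; apply/nondecreasing_seqP => M; elim: M c => [|M IH] c.
  by have /andP[] := digit_sum_itv 1 c b1.
by rewrite [leLHS]/= [leRHS]/= ler_pM2r ?invr_gt0 ?lerD2l//; lra.
Qed.

Lemma is_cvg_digit_sum b c : 1 < b -> cvgn (fun M => digit_sum b M c).
Proof.
move=> b1; apply: nondecreasing_is_cvgn; first exact: digit_sum_nondecreasing.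
by exists 1 => _ [M _ <-]; have /andP[] := digit_sum_itv M c b1.
Qed.

Lemma of_digits_itv b c : 1 < b -> 0 <= of_digits b c <= 1.
Proof.
move=> b1; apply/andP; split.
  apply: limr_ge; first exact: is_cvg_digit_sum.
  by apply: nearW => M; have /andP[] := digit_sum_itv M c b1.
apply: limr_le; first exact: is_cvg_digit_sum.
by apply: nearW => M; have /andP[] := digit_sum_itv M c b1.
Qed.

Lemma of_digitsE b c : 1 < b ->
  of_digits b c = ((b - 1) * (c 0%N)%:R + of_digits b (fun k => c k.+1)) / b.
Proof.
move=> b1; apply/cvg_lim => //; rewrite -cvg_shiftS /=.
apply: cvgM; last exact: cvg_cst.
apply: cvgD; first exact: cvg_cst.
exact: is_cvg_digit_sum.
Qed.

Lemma leading_digit_of_digits b c : 2 < b -> leading_digit (of_digits b c) = c 0%N.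
Proof.
move=> b2; have b1 : 1 < b by lra.
have /andP[s0 s1] := of_digits_itv (fun k => c k.+1) b1.
rewrite /leading_digit of_digitsE// ler_pdivlMr; last by lra.
case: (c 0%N); rewrite ?mulr1 ?mulr0 ?add0r.
  by apply/idP; lra.
by apply/negbTE; rewrite -ltNge; lra.
Qed.

(** In base greater than two, expansions with different leading digits lie in
    disjoint intervals, so the digits can be read off one after the other. *)
Lemma of_digitsK b c : 2 < b -> digit b (of_digits b c) = c.
Proof.
move=> b2; apply/funext => k; elim: k c => [|k IH] c.
  exact: leading_digit_of_digits.
rewrite digitS -(IH (fun k => c k.+1)); congr (digit _ _ _).
rewrite /digit_shift leading_digit_of_digits// of_digitsE; last by lra.
rewrite [b * _]mulrC divfK; first by rewrite addrAC subrr add0r.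
by rewrite gt_eqF//; lra.
Qed.

(** After [M] digits the remainder is the [M]-th iterate of the shift, scaled
    down by [2 ^ M]. *)
Lemma digit2K x : 0 <= x <= 1 -> of_digits 2 (digit 2 x) = x.
Proof.
move=> x01; apply/cvg_lim => //.
have bound M : forall x, 0 <= x <= 1 ->
    0 <= x - digit_sum 2 M (digit 2 x) <= 2^-1 ^+ M.
  elim: M => [|M IH] {x01}x x01; first by rewrite subr0 expr0.
  have y01 : 0 <= digit_shift 2 x <= 1.
    rewrite /digit_shift /leading_digit; move: x01 => /andP[x0 x1].
    case: (leP 2^-1 x) => hx; rewrite ?mulr1 ?mulr0; apply/andP; split; lra.
  have := IH _ y01; rewrite [digit_sum 2 M.+1 _]/=.
  have -> : (fun k => digit 2 x k.+1) = digit 2 (digit_shift 2 x).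
    by apply/funext => k; rewrite digitS.
  rewrite exprS /digit_shift /digit /=.
  set s := digit_sum _ _ _; set e := (_ ^+ _); set l := (leading_digit x)%:R.
  by move=> /andP[h1 h2]; apply/andP; split; lra.
apply/cvgrPdist_le => e e0; near=> M.
have /andP[h1 h2] := bound M _ x01.
rewrite ger0_norm// (le_trans h2)// ltW//.
by near: M; apply: cvgr_lt e0; apply: cvg_expr; rewrite ger0_norm; lra.
Unshelve. all: by end_near. Qed.

Section measurability.
Context d (T : measurableType d).

Lemma measurable_of_digits b (c : T -> nat -> bool) : 1 < b ->
  (forall k, measurable_fun setT (c ^~ k)) ->
  measurable_fun setT (fun t => of_digits b (c t)).
Proof.
move=> b1 mc; apply: (@measurable_fun_cvg _ _ _ _ (fun M t => digit_sum b M (c t))).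
  move=> M; elim: M c mc => [|M IH] c mc /=; first exact: measurable_cst.
  apply: measurable_funM; last exact: measurable_cst.
  apply: measurable_funD; last by apply: IH => k; exact: mc.
  apply: measurable_funM; first exact: measurable_cst.
  exact: (@measurableT_comp _ _ _ _ _ _ (fun a : bool => a%:R : R)).
by move=> t _; exact: is_cvg_digit_sum.
Qed.

Lemma measurable_leading_digit : measurable_fun setT leading_digit.
Proof.
exact: (measurable_fun_ler (measurable_cst (2^-1 : R)) (@measurable_id _ R setT)).
Qed.

Lemma measurable_digit b k : measurable_fun setT (fun x => digit b x k).
Proof.
apply: measurableT_comp; first exact: measurable_leading_digit.
elim: k => [|k IH] /=; first exact: measurable_id.
apply: (measurableT_comp _ IH).
apply: measurable_funB; first exact: mulrl_measurable.
apply: measurable_funM; first exact: measurable_cst.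
apply: (@measurableT_comp _ _ _ _ _ _ (fun a : bool => a%:R : R)) => //.
exact: measurable_leading_digit.
Qed.

End measurability.
End digits.

Section embedding.
Context (R : realType).
Local Notation OB := (OmegaBorel R).

Lemma clamp_itv (x : R) : 0 <= Num.max 0 (Num.min 1 x) <= 1.
Proof. by rewrite le_max lexx ge_max ler01 ge_min lexx. Qed.

Definition clamp (x : R) : {i01 R} :=
  Itv01 (andP (clamp_itv x)).1 (andP (clamp_itv x)).2.

Lemma clampE (x : R) : 0 <= x <= 1 -> (clamp x)%:num = x.
Proof. by move=> /andP[x0 x1]; rewrite /= min_r// max_r. Qed.

Lemma clampK (x : {i01 R}) : clamp x%:num = x.
Proof. by apply/val_inj/clampE; rewrite ge0 le1. Qed.

Lemma measurable_clamp : measurable_fun setT (fun x : R => (clamp x)%:num).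
Proof.
have mmin := measurable_minr (measurable_cst (1 : R)) (@measurable_id _ R setT).
exact: (measurable_maxr (measurable_cst (0 : R)) mmin).
Qed.

(** The binary digits of all the coordinates are merged into one sequence and
    reread in base three, where a number determines its digits. *)
Definition encode (w : OB) : R :=
  of_digits 3 (fun m => if unpickle m is Some (n, k) then digit 2 (w n)%:num k
                        else false).

Definition decode (x : R) : OB :=
  fun n => clamp (of_digits 2 (fun k => digit 3 x (pickle (n, k)))).

Lemma encodeK : cancel encode decode.
Proof.
move=> w; apply/funext => n; rewrite -[RHS]clampK /decode; congr clamp.
rewrite /encode of_digitsK; last by lra.
under [in LHS]eq_fun do rewrite pickleK.
by apply: digit2K; apply/andP; split.
Qed.

Lemma encode_itv w : 0 <= encode w <= 1.
Proof. by apply: of_digits_itv; lra. Qed.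

Lemma measurable_encode : measurable_fun setT encode.
Proof.
apply: measurable_of_digits; first by lra.
move=> m; case: (unpickle m) => [[n k]|]; last exact: measurable_cst.
apply: (measurableT_comp (measurable_digit 2 k)).
exact: measurable_coord.
Qed.

Lemma measurable_decode : measurable_fun setT decode.
Proof.
apply: measurable_to_borel => n; apply: (measurableT_comp measurable_clamp).
by apply: measurable_of_digits => [|k]; [lra|exact: measurable_digit].
Qed.

End embedding.

(** * Simulating a law from one uniform variable *)

Section uniform01.
Context (R : realType).
Local Notation unif01 := (uniform_prob (@ltr01 R)).

Lemma uniform01_itv (t : R) : 0 <= t <= 1 -> unif01 `]0, t]%classic = t%:E.
Proof.
move=> /andP[t0 t1]; rewrite /uniform_prob.
rewrite (eq_integral (fun=> 1%E)); last first.
  move=> x; rewrite inE/= in_itv/= => /andP[x0 xt].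
  by rewrite /uniform_pdf ltW//= (le_trans xt)// subr0 invr1.
rewrite integral_cst//= mul1e lebesgue_measure_itv/= lte_fin.
by case: ltgtP t0 => // [t0 _|<-]; rewrite ?sube0 ?oppr0 ?adde0.
Qed.

Lemma uniform01_restrict (A : set R) : measurable A ->
  unif01 A = unif01 (A `&` `]0, 1]%classic).
Proof.
move=> mA; rewrite -{1}(setIT A) -(setUv `]0, 1]%classic) setIUr measureU//.
- rewrite [X in (_ + X)%E](_ : _ = 0%E) ?adde0//.
  have C0 : unif01 (~` `]0, 1]%classic) = 0%E.
    rewrite probability_setC// [X in (_ - X)%E](_ : _ = 1%E) ?subee//.
    by apply: uniform01_itv; rewrite lexx ler01.
  apply/eqP; rewrite eq_le measure_ge0 andbT -C0.
  by apply: le_measure; rewrite ?inE//; [apply: measurableI => //|];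
    exact: measurableC.
- exact: measurableI.
- by apply: measurableI => //; exact: measurableC.
- by rewrite setIACA setICr setI0.
Qed.

End uniform01.

Lemma probability_rays_eq (R : realType) (P Q : probability R R) :
  (forall x, P `]-oo, x]%classic = Q `]-oo, x]%classic) ->
  forall B, measurable B -> P B = Q B.
Proof.
move=> PQ B mB.
refine (@measure_unique _ R _ (@RGenOInfty.G R) (fun k => `](- k%:R), +oo[%classic)
  (RGenOInfty.measurableE R) _ _ _ P Q _ _ B mB).
- move=> _ _ [x ->] [y ->]; exists (Num.max x y); apply/seteqP; split => z /=.
    by rewrite !in_itv/= !andbT gt_max => -[-> ->].
  by rewrite !in_itv/= !andbT gt_max => /andP[-> ->].
- by move=> k; exists (- k%:R).
- apply/seteqP; split => // x _; exists (Num.bound x) => //=.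
  by rewrite in_itv/= andbT ltrNl unstable.ltrNbound.
- move=> _ [x ->]; rewrite -setCitvl.
  by rewrite [LHS]probability_setC// [RHS]probability_setC// PQ.
- by move=> k; rewrite (le_lt_trans (probability_le1 _ _))// ltry.
Qed.

Section quantile.
Context (R : realType) d (T : measurableType d) (P : probability T R).
Variable X : {RV P >-> R}.
Hypothesis X01 : forall t, 0 <= X t <= 1.
Local Notation unif01 := (uniform_prob (@ltr01 R)).

Definition quantile (u : R) : R :=
  if 0 < u <= 1 then inf [set x | (u%:E <= cdf X x)%E] else 0.

Let cdf_neg x : x < 0 -> cdf X x = 0%E.
Proof.
move=> x0; rewrite /cdf /distribution /pushforward.
rewrite (_ : _ @^-1` _ = set0) ?measure0//; apply/seteqP; split => // t /=.
by rewrite in_itv/= => Xx; have /andP[] := X01 t; lra.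
Qed.

Let cdf1 : cdf X 1 = 1%E.
Proof.
rewrite /cdf /distribution /pushforward -(probability_setT P); congr (P _).
apply/seteqP; split => // t _ /=.
by rewrite in_itv/=; have /andP[] := X01 t.
Qed.

Let level_ge0 (u x : R) : 0 < u -> (u%:E <= cdf X x)%E -> 0 <= x.
Proof.
move=> u0 ux; rewrite leNgt; apply/negP => /cdf_neg Fx.
by move: ux; rewrite Fx lee_fin leNgt u0.
Qed.

(** Galois connection between quantile and distribution function; the
    implication from left to right is right continuity. *)
Lemma quantile_le (u x : R) : 0 < u <= 1 ->
  (quantile u <= x) = (u%:E <= cdf X x)%E.
Proof.
move=> u01; rewrite /quantile u01; have /andP[u0 u1] := u01.
set S := [set x | _].
have S1 : S 1 by rewrite /S/= cdf1 lee_fin.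
have S0 : has_lbound S by exists 0 => y; exact: level_ge0.
apply/idP/idP => [Sx|ux]; last exact: ge_inf.
have Fu y : x < y -> (u%:E <= cdf X y)%E.
  move=> xy; have [z Sz zy] : exists2 z, S z & z < y.
    by apply: inf_lt; [exists 1|exact: le_lt_trans Sx xy].
  by rewrite (le_trans Sz)// cdf_nondecreasing// ltW.
have cF := @cdf_right_continuous _ _ _ _ X x.
rewrite -(cvg_lim _ cF)//; apply: lime_ge; first by apply/cvg_ex; exists (cdf X x).
by near=> y; apply: Fu; near: y; exact: nbhs_right_gt.
Unshelve. all: by end_near. Qed.

Let fcdf x : cdf X x = (fine (cdf X x))%:E.
Proof. by rewrite fineK// fin_num_measure. Qed.

Let quantile_preimage x :
  (quantile @^-1` `]-oo, x]) `&` `]0, 1] = `]0, fine (cdf X x)]%classic.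
Proof.
have F1 := cdf_le1 X x; apply/seteqP; split => u /=.
  by rewrite !in_itv/= => -[qu u01]; move: qu;
    rewrite quantile_le// fcdf lee_fin => ->; case/andP: u01 => ->.
rewrite !in_itv/= => /andP[u0 uF].
have u1 : u <= 1 by rewrite (le_trans uF)// -lee_fin -fcdf.
by rewrite u0 u1; split=> //; rewrite quantile_le ?u0// fcdf lee_fin.
Qed.

Lemma measurable_quantile :
  @measurable_fun _ _ (measurableTypeR R) R setT quantile.
Proof.
refine (@measurability _ _ (measurableTypeR R) R _ _ _
  (RGenOInfty.measurableE R) _) => _ [_ [x ->] <-].
rewrite setTI -setCitvl preimage_setC; apply: measurableC.
rewrite -[X in measurable X]setIT -(setUv `]0, 1]%classic) setIUr.
apply: measurableU; first by rewrite quantile_preimage.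
rewrite (_ : _ `&` _ = if 0 <= x then ~` `]0, 1]%classic else set0).
  by case: ifP => _ //; exact: measurableC.
apply/seteqP; split => u.
  by move=> [/=]; rewrite !in_itv/= => + /negP u01; rewrite /quantile (negbTE u01) => ->;
    rewrite /= in_itv/=; exact/negP.
by case: ifPn => // x0 /= /negP u01; rewrite !in_itv/= in u01 *;
  rewrite /quantile (negbTE u01); split => //; exact/negP.
Qed.

Lemma quantile_law (B : set R) : measurable B ->
  unif01 (quantile @^-1` B) = distribution P X B.
Proof.
pose q : {RV unif01 >-> R} :=
  @mfun_Sub _ _ (measurableTypeR R) R quantile (mem_set measurable_quantile).
move=> mB; refine (@probability_rays_eq R (distribution unif01 q)
  (distribution P X) _ B mB) => x.
rewrite /distribution /pushforward /= uniform01_restrict; last first.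
  by rewrite -[X in measurable X]setTI; exact: measurable_quantile.
rewrite quantile_preimage uniform01_itv; first by rewrite -fcdf.
by rewrite -!lee_fin -fcdf cdf_ge0 cdf_le1.
Qed.

End quantile.

(** Encode the random sequence as a real, simulate that real by its quantile
    function, decode. *)
Lemma borel_sampler (R : realType) d (T : measurableType d)
    (P : probability T R) (f : T -> OmegaBorel R) : measurable_fun setT f ->
  exists2 g : measurableTypeR R -> OmegaBorel R,
      @measurable_fun _ _ (measurableTypeR R) (OmegaBorel R) setT g &
    forall B, measurable B ->
      uniform_prob (@ltr01 R) (g @^-1` B) = P (f @^-1` B).
Proof.
move=> mf; have mX : measurable_fun setT (@encode R \o f).
  exact: measurableT_comp (@measurable_encode R) mf.
pose X : {RV P >-> R} := mfun_Sub (mem_set mX).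
have X01 t : 0 <= X t <= 1 by exact: encode_itv.
have mg := measurableT_comp (@measurable_decode R) (measurable_quantile X01).
exists (@decode R \o quantile X) => // B mB.
rewrite comp_preimage (quantile_law X01); last first.
  by rewrite -[X in measurable X]setTI; exact: measurable_decode.
rewrite /distribution /pushforward; congr (P _).
by apply/seteqP; split => t /=; rewrite encodeK.
Qed.

(** * The uniform law on sequences *)

Section cylinders.
Context (R : realType).
Local Notation Om := (Omega R).
Local Notation OB := (OmegaBorel R).
Local Notation unif01 := (uniform_prob (@ltr01 R)).

Definition cylinder n (B : nat -> set R) : set OB :=
  [set w | forall i, (i < n)%N -> B i (w i)%:num].

Lemma measurable_cylinder n (B : nat -> set R) :
  (forall i, measurable (B i)) -> measurable (cylinder n B).
Proof.
move=> mB; rewrite (_ : cylinder n B = \bigcap_i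
    ((fun w : OB => (w i)%:num) @^-1` (if (i < n)%N then B i else setT))).
  apply: bigcapT_measurable => i; rewrite -[X in measurable X]setTI.
  by apply: (measurable_coord i) => //; case: ifP.
apply/seteqP; split => w /= Bw i; last by move=> ni; have := Bw i Logic.I; rewrite ni.
by move=> _ /=; case: ifP => // ni; exact: Bw.
Qed.

Definition cylinders : set (set OB) :=
  [set A | exists n B, (forall i, measurable (B i)) /\ A = cylinder n B].

Lemma cylinders_setI : setI_closed cylinders.
Proof.
move=> _ _ [n [B [mB ->]]] [m [C [mC ->]]].
pose trunc k (A : nat -> set R) i := if (i < k)%N then A i else setT.
exists (maxn n m), (fun i => trunc n B i `&` trunc m C i); split.
  by move=> i; apply: measurableI; rewrite /trunc; case: ifP.
apply/seteqP; split => w /= => [[Bw Cw] i _|BCw].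
  by rewrite /trunc; split; case: ifP => // im; [exact: Bw|exact: Cw].
by split => i im; have := BCw i; rewrite /trunc leq_max im ?orbT => /(_ isT)[].
Qed.

Lemma sigma_cylinders : @measurable _ OB = <<s cylinders >>.
Proof.
apply/seteqP; split; apply: smallest_sub; try exact: smallest_sigma_algebra.
  move=> _ [n [B [mB ->]]]; apply: sub_sigma_algebra.
  exists n.+1, (fun i => if i == n then B else setT); split.
    by move=> i; case: ifP.
  apply/seteqP; split => w /=; first by move=> Bw i _; case: eqP => // ->.
  by move=> /(_ n (ltnSn n)); rewrite eqxx.
by move=> _ [n [B [mB ->]]]; exact: measurable_cylinder.
Qed.

Lemma is_uniform_unique (P Q : probability Om R) :
  is_uniform P -> is_uniform Q ->
  forall A : set Om, measurable A -> P A = Q A.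
Proof.
move=> uP uQ; apply: um_probability_eq => B mB.
refine (@measure_unique _ _ OB cylinders (fun=> cylinder 0 (fun=> setT))
  sigma_cylinders cylinders_setI _ _ (borel_part P) (borel_part Q) _ _ B mB).
- by move=> _; exists 0%N, (fun=> setT).
- by apply/seteqP; split => // w _; exists 0%N.
- by move=> _ [n [C [mC ->]]]; rewrite [LHS]uP// [RHS]uQ.
- by move=> _; rewrite (le_lt_trans (probability_le1 _ _)) ?ltry//;
    exact: measurable_cylinder.
Qed.

End cylinders.

Section uniform_exists.
Context (R : realType).
Local Notation Om := (Omega R).
Local Notation OB := (OmegaBorel R).
Local Notation I := (measurableTypeR R).
Local Notation unif01 := (uniform_prob (@ltr01 R)).

Lemma uniform01_clamp (B : set R) : measurable B ->
  unif01 ((fun x : R => (clamp x)%:num) @^-1` B) = unif01 B.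
Proof.
move=> mB; rewrite uniform01_restrict; last first.
  by rewrite -[X in measurable X]setTI; exact: measurable_clamp.
rewrite [RHS]uniform01_restrict//; congr (unif01 _).
apply/seteqP; split => x /=; rewrite in_itv/= => -[+ /andP[x0 x1]];
  by rewrite clampE ?x0 ?x1 ?(ltW x0).
Qed.

(** The pair of independent uniform variables is itself simulated from one
    uniform variable, as the first two coordinates of a sequence. *)
Lemma uniform_split : exists g : I -> OB,
  @measurable_fun _ _ I OB setT g /\
  forall B C : set R, measurable B -> measurable C ->
    unif01 [set u | B (g u 0%N)%:num /\ C (g u 1%N)%:num]
    = (unif01 B * unif01 C)%E.
Proof.
pose f (p : I * I) : OB := fun n => if n is 0%N then clamp p.1 else clamp p.2.
have mf : measurable_fun setT f.
  apply: measurable_to_borel => -[|n].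
    exact: (measurableT_comp (@measurable_clamp R) measurable_fst).
  exact: (measurableT_comp (@measurable_clamp R) measurable_snd).
have [g mg gE] := borel_sampler (unif01 \x unif01)%E mf.
exists g; split => // B C mB mC.
pose A : set OB := [set w | B (w 0%N)%:num] `&` [set w | C (w 1%N)%:num].
have mA : measurable A.
  apply: measurableI; rewrite -[X in measurable X]setTI.
    exact: (measurable_coord 0).
  exact: (measurable_coord 1).
rewrite -(uniform01_clamp mB) -(uniform01_clamp mC) -product_measure1E//.
- exact: (gE _ mA).
- by rewrite -[X in measurable X]setTI; exact: (@measurable_clamp R).
- by rewrite -[X in measurable X]setTI; exact: (@measurable_clamp R).
Qed.

(** Splitting a uniform variable yields a coordinate and a fresh uniform
    variable, independent of it, which is split in turn. *)
Lemma is_uniform_exists : exists P : probability Om R, is_uniform P.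
Proof.
have [g [mg gE]] := uniform_split.
pose S (u : R) : R := (g u 1%N)%:num.
pose V (u : I) : OB := fun i => g (iter i S u) 0%N.
have mS : @measurable_fun _ _ I I setT S.
  exact: (measurableT_comp (measurable_coord 1) mg).
have mV : measurable_fun setT V.
  apply: measurable_to_borel => i.
  have mi : @measurable_fun _ _ I I setT (iter i S).
    elim: i => [|i IH]; first exact: (@measurable_id _ I setT).
    exact: (measurableT_comp mS IH).
  exact: (measurableT_comp (measurable_coord 0) (measurableT_comp mg mi)).
exists (um_ext (distribution unif01 (mfun_Sub (mem_set mV)))) => n B mB.
rewrite [LHS]um_extE; last exact: (measurable_cylinder n mB).
rewrite /distribution /pushforward /=.
elim: n B mB => [|n IH] B mB.
  rewrite big_ord0 -(probability_setT unif01); congr (unif01 _).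
  by apply/seteqP; split.
rewrite big_ord_recl -(IH (fun i => B i.+1))// -gE//; last first.
  rewrite -[X in measurable X]setTI.
  exact: (mV measurableT _ (measurable_cylinder n (fun i => mB i.+1))).
congr (unif01 _); apply/seteqP; split => u /=.
  move=> Bu; split; first exact: (Bu 0%N).
  by move=> i ni; have := Bu i.+1 ni; rewrite /V iterSr.
move=> [B0 Bu] [|i] ni //=.
by have := Bu i ni; rewrite /V iterSr.
Qed.

Lemma unifP : is_uniform (unif R).
Proof. exact: (xgetPex _ is_uniform_exists). Qed.

End uniform_exists.

Section uniform_theory.
Context (R : realType).
Local Notation Om := (Omega R).
Local Notation OB := (OmegaBorel R).
Local Notation unif01 := (uniform_prob (@ltr01 R)).
Local Notation U := (unif R).

Lemma measurable_um_preimage (f : Om -> Om) (A : set Om) :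
  measurable_fun setT f -> measurable A -> measurable (f @^-1` A).
Proof. by move=> mf mA; rewrite -[X in measurable X]setTI; exact: mf. Qed.

(** The first coordinate alone is enough randomness to simulate [P]. *)
Lemma um_sampler (P : probability Om R) : exists2 f : Om -> Om,
  measurable_fun setT f &
  forall A : set Om, measurable A -> P A = U (f @^-1` A).
Proof.
have [g mg gE] := borel_sampler P (@measurable_um_borel R).
pose f (w : Om) : Om := g (w 0%N)%:num.
have mf : measurable_fun setT f.
  apply: measurable_to_um.
  exact: (measurableT_comp mg (measurable_coord_um 0)).
exists f => //.
pose F : {mfun Om >-> Om} := mfun_Sub (mem_set mf).
apply: (um_probability_eq (Q2 := distribution U F)) => B mB.
have := @unifP R 1%N (fun=> g @^-1` B).
rewrite big_ord1 gE// => <-; last first.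
  by move=> _; rewrite -[X in measurable X]setTI; exact: mg.
rewrite /distribution /pushforward; congr (U _).
apply/seteqP; split => w /=; first exact.
by move=> + [|//].
Qed.

(** An injection reads distinct coordinates at distinct places, so they stay
    independent and uniform. *)
Lemma unif_reindex (s s' : nat -> nat) : cancel s s' ->
  forall A : set Om, measurable A -> U ((fun w n => w (s n)) @^-1` A) = U A.
Proof.
move=> sK A mA.
pose f (w : Om) : Om := fun n => w (s n).
have mf : measurable_fun setT f.
  by apply: measurable_to_um; apply: measurable_to_borel => n; exact: measurable_coord_um.
pose F : {mfun Om >-> Om} := mfun_Sub (mem_set mf).
apply: (is_uniform_unique (P := distribution U F)) mA; last exact: unifP.
move=> n B mB; rewrite /distribution /pushforward.
pose N := (\max_(i < n) (s i).+1)%N.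
have sN i : (i < n)%N -> (s i < N)%N.
  by move=> ni; exact: (@leq_bigmax _ (fun i : 'I_n => (s i).+1) (Ordinal ni)).
(* Coordinate [j] is constrained when it lies in the image of [s]. *)
pose hit j := (s' j < n)%N && (s (s' j) == j).
pose C j := if hit j then B (s' j) else setT.
have mC j : measurable (C j) by rewrite /C; case: ifP.
transitivity (U (cylinder N C)).
  congr (U _); apply/seteqP; split => w /=.
    move=> Bw j jN; rewrite /C; case: ifP => // /andP[jn /eqP sj].
    by have := Bw _ jn; rewrite /f sj.
  move=> Cw i ni; have := Cw _ (sN _ ni).
  by rewrite /C /hit sK ni eqxx.
rewrite [LHS](@unifP R N C mC).
rewrite -(big_mkord xpredT (fun j => unif01 (C j))).
rewrite -(big_mkord xpredT (fun j => unif01 (B j))).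
rewrite (bigID hit) /= [X in (_ * X)%E]big1 ?mule1; last first.
  by move=> j /negbTE hj; rewrite /C hj probability_setT.
rewrite -big_filter; have -> : \big[*%E/1%E]_(0 <= j < n) unif01 (B j) =
    \big[*%E/1%E]_(j <- map s (iota 0 n)) unif01 (C j).
  rewrite big_map /index_iota subn0 big_seq [RHS]big_seq; apply: eq_bigr => j.
  by rewrite mem_iota /C /hit sK eqxx => /= ->.
apply: perm_big; apply: uniq_perm.
- by rewrite filter_uniq// iota_uniq.
- by rewrite (map_inj_uniq (can_inj sK)) iota_uniq.
- move=> j; rewrite mem_filter mem_index_iota; apply/idP/mapP => [|[i]].
    by move=> /andP[/andP[jn /eqP sj] _]; exists (s' j); rewrite ?mem_iota.
  by rewrite mem_iota /= add0n => ni ->; rewrite /hit sK ni eqxx sN.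
Qed.

End uniform_theory.

(** * Splitting a random sequence into two independent ones *)

(** The maps [theta1], [theta2] and [thetaV] for entries of any type, so that
    they also act on sequences of indices. *)
Section rearrangements.

Definition evens T (s : nat -> T) n := s n.*2.
Definition odds T (s : nat -> T) n := s n.*2.+1.
Definition interleave T (s s' : nat -> T) n := if odd n then s' n./2 else s n./2.

Lemma evens_interleave T (s s' : nat -> T) : evens (interleave s s') = s.
Proof. by apply/funext => n; rewrite /evens /interleave odd_double doubleK. Qed.

Lemma odds_interleave T (s s' : nat -> T) : odds (interleave s s') = s'.
Proof.
by apply/funext => n; rewrite /odds /interleave/= odd_double/= uphalf_double.
Qed.

Lemma interleaveK T (s : nat -> T) : interleave (evens s) (odds s) = s.
Proof.
apply/funext => n; rewrite /evens /odds /interleave; case: ifPn => on.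
  by rewrite -[in RHS](odd_double_half n) on.
by rewrite -[in RHS](odd_double_half n) (negbTE on).
Qed.

Lemma comp_interleave T T' (f : T -> T') (s s' : nat -> T) :
  f \o interleave s s' = interleave (f \o s) (f \o s').
Proof. by apply/funext => n; rewrite /interleave /=; case: odd. Qed.

End rearrangements.

Section splitting.
Context (R : realType).
Local Notation Om := (Omega R).
Local Notation OB := (OmegaBorel R).
Local Notation unif01 := (uniform_prob (@ltr01 R)).
Local Notation U := (unif R).
Implicit Types (w : Om) (A B C : set Om).

Lemma theta1V w w' : theta1 (thetaV w w') = w.
Proof. exact: evens_interleave. Qed.

Lemma theta2V w w' : theta2 (thetaV w w') = w'.
Proof. exact: odds_interleave. Qed.

Lemma measurable_theta1 : measurable_fun setT (@theta1 R).
Proof.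
by apply: measurable_to_um; apply: measurable_to_borel => n; exact: measurable_coord_um.
Qed.

Lemma measurable_theta2 : measurable_fun setT (@theta2 R).
Proof.
by apply: measurable_to_um; apply: measurable_to_borel => n; exact: measurable_coord_um.
Qed.

Lemma measurable_thetaV_borel d (T : measurableType d) (f g : T -> Om) :
  measurable_fun setT f -> measurable_fun setT g ->
  measurable_fun setT (fun x => thetaV (f x) (g x) : OB).
Proof.
move=> mf mg; apply: measurable_to_borel => n; rewrite /thetaV.
case: (odd n); first exact: (measurableT_comp (measurable_coord_um _) mg).
exact: (measurableT_comp (measurable_coord_um _) mf).
Qed.

Lemma measurable_thetaV (f g : Om -> Om) :
  measurable_fun setT f -> measurable_fun setT g ->
  measurable_fun setT (fun w => thetaV (f w) (g w)).
Proof. by move=> mf mg; apply: measurable_to_um; exact: measurable_thetaV_borel. Qed.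

Lemma measurable_thetaV2 w : measurable_fun setT (thetaV w).
Proof. exact: (measurable_thetaV (measurable_cst w) (@measurable_id _ _ _)). Qed.

Definition section C w : set Om := [set w' | C (thetaV w w')].

Lemma measurable_section C w : measurable C -> measurable (section C w).
Proof. exact/measurable_um_preimage/measurable_thetaV2. Qed.

Let join (p : Om * Om) : OB := thetaV p.1 p.2.

Let measurable_join : measurable_fun setT join.
Proof. exact: (measurable_thetaV_borel measurable_fst measurable_snd). Qed.

Let xsection_join C w : xsection (join @^-1` C) w = section C w.
Proof. by apply/seteqP; split => w'; rewrite /xsection /section/= inE. Qed.

Let join_law (Q : probability Om R) : probability Om R :=
  um_ext (distribution (Q \x U)%E (mfun_Sub (mem_set measurable_join))).

Let join_lawE (Q : probability Om R) (B : set OB) : measurable B ->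
  join_law Q B = (\int[Q]_w U (section B w))%E.
Proof.
move=> mB; rewrite [LHS]um_extE// /distribution /pushforward /product_measure1.
by apply: eq_integral => w _; rewrite /= xsection_join.
Qed.

Let measurable_section_borel (B : set OB) : measurable B ->
  measurable_fun setT (fun w => U (section B w)).
Proof.
move=> mB; have mJ : measurable (join @^-1` B).
  by rewrite -[X in measurable X]setTI; exact: measurable_join.
have := measurable_fun_xsection U mJ; apply: eq_measurable_fun => w _.
by rewrite /= xsection_join.
Qed.

(* A cylinder of the joined sequence is a rectangle: the even-indexed
   constraints bear on one factor, the odd-indexed ones on the other. *)
Let join_unif A : measurable A -> join_law U A = U A.
Proof.
apply: is_uniform_unique; last exact: unifP.
move=> n B mB; rewrite [LHS]um_extE; last exact: (measurable_cylinder n mB).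
pose f i := if (i < n)%N then B i else setT.
have mf i : measurable (f i) by rewrite /f; case: ifP.
have half_lt i : (i < n)%N -> (i./2 < n)%N.
  by apply: leq_ltn_trans; rewrite -divn2 leq_div.
transitivity ((U \x U)%E (cylinder n (fun j => f j.*2) `*`
    cylinder n (fun j => f j.*2.+1))).
  congr ((U \x U)%E _); apply/seteqP; split => -[w w'] /=.
    move=> Bw; split => i ni; rewrite /f; case: ifP => // h; have := Bw _ h;
    by rewrite /join /thetaV/= odd_double/= ?uphalf_double ?doubleK.
  move=> [Bw Bw'] i ni; rewrite /join /thetaV/=; case: ifPn => oi.
    have e : i./2.*2.+1 = i by rewrite -[RHS](odd_double_half i) oi.
    by have := Bw' _ (half_lt _ ni); rewrite /f e ni.
  have e : i./2.*2 = i by rewrite -[RHS](odd_double_half i) (negbTE oi).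
  by have := Bw _ (half_lt _ ni); rewrite /f e ni.
have mc (h : nat -> nat) : @measurable _ Om (cylinder n (fun j => f (h j))).
  exact: (borel_um (measurable_cylinder n (fun j => mf (h j)))).
rewrite product_measure1E; [|exact: mc double|exact: (mc (fun j => j.*2.+1))].
rewrite [X in (X * _)%E](@unifP R n (fun j => f j.*2))//.
rewrite [X in (_ * X)%E](@unifP R n (fun j => f j.*2.+1))//.
pose F i := unif01 (f i).
have -> : forall k,
    (\prod_(i < k) F i.*2 * \prod_(i < k) F i.*2.+1 = \prod_(0 <= i < k.*2) F i)%E.
  elim => [|k IH]; first by rewrite !big_ord0 big_nil mule1.
  by rewrite doubleS !big_nat_recr//= !big_ord_recr/= -IH muleACA muleA.
rewrite (big_cat_nat (n := n))//=; last by rewrite -addnn leq_addr.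
rewrite [X in (_ * X)%E]big1_seq ?mule1; last first.
  move=> i /=; rewrite mem_index_iota => /andP[ni _].
  by rewrite /F /f ltnNge ni probability_setT.
rewrite -(big_mkord xpredT (fun i => unif01 (B i))) big_seq [RHS]big_seq.
by apply: eq_bigr => i; rewrite mem_index_iota /F /f => /= ->.
Qed.

(** For the law of the joined sequence, a universally measurable set lies
    between a Borel set and its union with a null set, almost all of whose
    sections are null. *)
Let section_ae (Q : probability Om R) A : measurable A ->
  exists (B : set OB) (Z : set Om), [/\ measurable B, measurable Z, Q Z = 0%E,
    join_law Q A = join_law Q B &
    forall w, ~ Z w -> U (section A w) = U (section B w)].
Proof.
move=> mA; have [B [N [mB mN N0 BA ABN]]] := um_sandwich (join_law Q) mA.
have mU := measurable_section_borel mN.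
pose Z := [set w | U (section N w) != 0%E].
have mBu := borel_um mB; have mNu := borel_um mN.
exists B, Z; split => //.
- have := emeasurable_neq measurableT mU 0%E; rewrite setTI; exact.
- have /(ae_eq_integral_abs Q measurableT mU) [Y [mY Y0 ZY]] :
      (\int[Q]_w `|U (section N w)| = 0)%E.
    rewrite -N0 join_lawE//; apply: eq_integral => w _.
    by rewrite gee0_abs// measure_ge0.
  have mZ : measurable Z.
    by have := emeasurable_neq measurableT mU 0%E; rewrite setTI.
  apply/(negligibleP Q mZ); exists Y; split => //.
  by move=> w Zw; apply: ZY => /= /(_ Logic.I); apply/eqP.
- exact: measure_sandwich N0 BA ABN.
- move=> w /negP; rewrite negbK => /eqP Nw.
  apply: (measure_sandwich _ _ _ Nw); try exact: measurable_section.
    by move=> w'; exact: BA.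
  by move=> w' /ABN.
Qed.

(** Every probability sees this function as almost surely equal to a Borel
    one. *)
Lemma measurable_unif_section A : measurable A ->
  measurable_fun setT (fun w => U (section A w)).
Proof.
move=> mA; apply: (measurability _ (ErealGenOInfty.measurableE R)).
move=> _ [_ [r ->] <-]; rewrite setTI; apply: um_ae => Q.
have [B [Z [mB mZ Z0 _ AB]]] := section_ae Q mA.
exists [set w | (r%:E < U (section B w))%E], Z; split => //.
  by have := emeasurable_fun_o_infty measurableT (measurable_section_borel mB) r%:E;
    rewrite setTI.
by move=> w nZ /=; rewrite in_itv/= andbT AB.
Qed.

(** The join of two independent uniform sequences is uniform, so this is
    Fubini's theorem for a Borel set that agrees with [A] almost surely. *)
Lemma unif_fubini A : measurable A ->
  (\int[U]_w U (section A w) = U A)%E.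
Proof.
move=> mA; have [B [Z [mB mZ Z0 AB secAB]]] := section_ae U mA.
rewrite -join_unif// AB join_lawE//; apply: ae_eq_integral => //.
- exact: measurable_unif_section.
- exact: measurable_section_borel.
- exists Z; split => // w /=; apply: contra_notP => nZ _; exact: secAB.
Qed.

End splitting.

(** * Smooth maps between Euclidean spaces compose *)

Section smooth_maps.
Context (R : realType).

Section product_rule.
Context (V W : normedModType R).

Lemma scale_is_bilinear :
  bilinear_for
    (GRing.Scale.Law.clone _ _ *:%R _) (GRing.Scale.Law.clone _ _ *:%R _)
    (@GRing.scale R W : R -> W -> W).
Proof.
split=> [u'|u] a x y /=; first by rewrite scalerDl -scalerA.
by rewrite scalerDr !scalerA mulrC.
Qed.

HB.instance Definition _ := bilinear_isBilinear.Build R R W W _ _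
  (@GRing.scale R W : R -> W -> W) scale_is_bilinear.

Lemma is_diff_scale (a : V -> R) (b : V -> W) (x : V) :
  differentiable a x -> differentiable b x ->
  differentiable (fun t => a t *: b t) x /\
  forall v, 'D_v (fun t => a t *: b t) x = 'D_v a x *: b x + a x *: 'D_v b x.
Proof.
move=> da db.
have dab := differentiable_pair da db.
have sc : continuous (fun p : R * W => p.1 *: p.2) by exact: scale_continuous.
have ds : differentiable (fun p : R * W => p.1 *: p.2) (a x, b x).
  exact: (@differentiable_bilin _ _ _ _ (@GRing.scale R W : R -> W -> W)).
have dc : differentiable (fun t => a t *: b t) x.
  exact: (differentiable_comp dab ds).
split=> // v; rewrite !deriveE//.
have := diff_comp dab ds.
rewrite (@diff_bilin _ _ _ _ (@GRing.scale R W : R -> W -> W))//.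
rewrite (diff_pair da db) => /(congr1 (@^~ v)) /= e.
by rewrite [LHS]e addrC.
Qed.

End product_rule.

Lemma is_diff_coord (V : normedModType R) n (a : V -> 'rV[R]_n) (x : V) j :
  differentiable a x -> differentiable (fun t => a t 0 j) x /\
  forall v, 'D_v (fun t => a t 0 j) x = ('D_v a x) 0 j.
Proof.
move=> da; pose c (M : 'rV[R]_n) : R := M 0 j.
have lc : linear c by move=> k u v; rewrite /c !mxE.
pose cL : {linear 'rV[R]_n -> R} := HB.pack c (GRing.isLinear.Build _ _ _ _ _ lc).
have cc : continuous cL by exact: coord_continuous.
have dc : differentiable cL (a x) by exact: linear_differentiable.
have dca : differentiable (fun t => a t 0 j) x by exact: (differentiable_comp da dc).
split=> // v; rewrite !deriveE//.
have := diff_comp da dc; rewrite (diff_lin _ cc) => /(congr1 (@^~ v)) /= e.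
exact: e.
Qed.

(** The chain rule, with the inner derivative expanded in coordinates so that
    the outer map is differentiated along fixed directions only. *)
Lemma derive_comp m n p (f : 'rV[R]_n -> 'rV[R]_p) (g : 'rV[R]_m -> 'rV[R]_n)
    (t v : 'rV[R]_m) :
  differentiable g t -> differentiable f (g t) ->
  'D_v (f \o g) t
  = \sum_(j < n) ('D_v g t) 0 j *: 'D_(delta_mx 0 j) f (g t).
Proof.
move=> dg df; rewrite deriveE; last exact: differentiable_comp.
rewrite diff_comp//= [in LHS](row_sum_delta ('d g t v)) linear_sum.
by apply: eq_bigr => j _; rewrite linearZ !deriveE.
Qed.

Lemma Ck_continuous m n k (f : 'rV[R]_m -> 'rV[R]_n) : Ck k f -> continuous f.
Proof. by case: k => [//|k] [df _] t; exact: differentiable_continuous. Qed.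

Lemma CkS m n k (f : 'rV[R]_m -> 'rV[R]_n) : Ck k.+1 f -> Ck k f.
Proof.
elim: k f => [|k IH] f; first exact: Ck_continuous.
by move=> [df Df]; split=> // v; exact/IH/Df.
Qed.

Lemma Ck_cst m n k (c : 'rV[R]_n) : Ck k (fun _ : 'rV[R]_m => c).
Proof.
elim: k c => [|k IH] c; first exact: cst_continuous.
split=> [t|v]; first exact: differentiable_cst.
suff -> : (fun t => 'D_v (fun=> c) t) = (fun=> 0 : 'rV[R]_n) by exact: IH.
by apply/funext => t; exact: derive_cst.
Qed.

Lemma Ck_add m n k (f g : 'rV[R]_m -> 'rV[R]_n) :
  Ck k f -> Ck k g -> Ck k (f + g).
Proof.
elim: k f g => [|k IH] f g; first by move=> cf cg t; exact: (cvgD (cf t) (cg t)).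
move=> [df Df] [dg Dg]; split=> [t|v]; first exact: differentiableD.
suff -> : (fun t => 'D_v (f + g) t) = (fun t => 'D_v f t) + (fun t => 'D_v g t).
  by apply: IH; [exact: Df|exact: Dg].
by apply/funext => t; rewrite deriveD//; exact: diff_derivable.
Qed.

Lemma Ck_sum m n k q (f : 'I_q -> 'rV[R]_m -> 'rV[R]_n) :
  (forall j, Ck k (f j)) -> Ck k (fun t => \sum_(j < q) f j t).
Proof.
elim: q f => [|q IH] f Cf.
  under eq_fun do rewrite big_ord0.
  exact: Ck_cst.
suff -> : (fun t => \sum_(j < q.+1) f j t) =
    (fun t => \sum_(j < q) f (widen_ord (leqnSn q) j) t) + f ord_max.
  by apply: Ck_add => //; exact: IH.
by apply/funext => t; rewrite big_ord_recr.
Qed.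

(** The scalar factor is a coordinate of a vector-valued map, since [Ck] is
    defined for maps into row vectors. *)
Lemma Ck_scale m n p k (a : 'rV[R]_m -> 'rV[R]_p) (b : 'rV[R]_m -> 'rV[R]_n) j :
  Ck k a -> Ck k b -> Ck k (fun t => a t 0 j *: b t).
Proof.
elim: k a b => [|k IH] a b.
  move=> ca cb t; have h : {for t, continuous ((fun M : 'rV[R]_p => M 0 j) \o a)}.
    by apply: continuous_comp; [exact: ca|exact: coord_continuous].
  exact: (@cvgZ _ _ _ (nbhs t) _ _ _ _ _ h (cb t)).
move=> Ca Cb; have [da Da] := Ca; have [db Db] := Cb.
have dab t := is_diff_scale (is_diff_coord j (da t)).1 (db t).
split=> [t|v]; first exact: (dab t).1.
suff -> : (fun t => 'D_v (fun t => a t 0 j *: b t) t) =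
    (fun t => ('D_v a t) 0 j *: b t) + (fun t => a t 0 j *: 'D_v b t).
  apply: Ck_add; first by apply: IH; [exact: Da|exact: CkS].
  by apply: IH; [exact: CkS|exact: Db].
apply/funext => t; rewrite (dab t).2.
by rewrite (is_diff_coord j (da t)).2.
Qed.

(** By the chain rule the derivatives of a composite are sums of products of
    derivatives of the inner map with composites one order lower. *)
Lemma Ck_comp m n p k (f : 'rV[R]_n -> 'rV[R]_p) (g : 'rV[R]_m -> 'rV[R]_n) :
  Ck k f -> Ck k g -> Ck k (f \o g).
Proof.
elim: k f g => [|k IH] f g.
  by move=> cf cg t; apply: continuous_comp; [exact: cg|exact: cf].
move=> Cf Cg; have [df Df] := Cf; have [dg Dg] := Cg.
split=> [t|v]; first exact: differentiable_comp.
suff -> : (fun t => 'D_v (f \o g) t) =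
    fun t => \sum_(j < n) ('D_v g t) 0 j *: ('D_(delta_mx 0 j) f \o g) t.
  by apply: Ck_sum => j; apply: Ck_scale; [exact: Dg|apply: IH; [exact: Df|exact: CkS]].
by apply/funext => t; exact: derive_comp.
Qed.

Lemma Cinfty_comp m n p (f : 'rV[R]_n -> 'rV[R]_p) (g : 'rV[R]_m -> 'rV[R]_n) :
  Cinfty f -> Cinfty g -> Cinfty (f \o g).
Proof. by move=> Cf Cg k; exact: Ck_comp. Qed.

End smooth_maps.

Section caratheodory_functions.
Context (R : realType).
Local Notation rVm n := (g_sigma_algebraType (@open 'rV[R]_n)).

Lemma measurable_rV_coord n (j : 'I_n) :
  measurable_fun setT ((fun x => x 0 j) : rVm n -> R).
Proof.
refine (@measurability _ _ (rVm n) R _ _ _ (RGenOInfty.measurableE R) _).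
move=> _ [_ [x ->] <-]; rewrite setTI; apply: sub_sigma_algebra.
apply: open_comp; last exact: interval_open.
by move=> M _; exact: coord_continuous.
Qed.

Lemma measurable_to_rV1 d (T : measurableType d) (f : T -> rVm 1) :
  measurable_fun setT (fun t => f t 0 0) -> measurable_fun setT f.
Proof.
move=> mf; refine (@measurability _ _ T (rVm 1) _ _ _ erefl _).
move=> _ [V oV <-]; rewrite setTI.
pose s (r : R) : 'rV[R]_1 := r *: const_mx 1.
have fE t : f t = s (f t 0 0).
  by apply/rowP => j; rewrite !mxE mulr1 ord1.
have sV : open (s @^-1` V).
  by apply: open_comp => // r _; exact: scalel_continuous.
have := mf measurableT _ (open_measurable sV); rewrite setTI.
by congr (measurable _); apply/seteqP; split => t /=; rewrite -fE.
Qed.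

Definition lattice_index n k (x : 'rV[R]_n) : 'rV[int]_n :=
  \row_j Num.floor (x 0 j * k.+1%:R).

Definition lattice_point n k (z : 'rV[int]_n) : 'rV[R]_n :=
  \row_j ((z 0 j)%:~R / k.+1%:R).

Lemma cvg_lattice_point n (x : 'rV[R]_n) :
  (fun k => lattice_point k (lattice_index k x)) @ \oo --> x.
Proof.
apply/cvg_ballP => e e0; near=> k; split=> // i j.
rewrite /ball /= /ball_/= !mxE ord1.
have k0 : 0 < k.+1%:R :> R by [].
set y : R := x 0 j; rewrite -[X in `|X - _|](mulfK (lt0r_neq0 k0)).
rewrite -mulrBl normrM ger0_norm ?subr_ge0 ?ge_floor//.
rewrite [`|k.+1%:R^-1|]gtr0_norm ?invr_gt0//.
rewrite (@le_lt_trans _ _ k.+1%:R^-1)//.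
  rewrite ler_piMl// lerBlDl ltW//.
  by have := floorD1_gt (y * k.+1%:R); rewrite intrD.
by near: k; apply: near_infty_natSinv_lt (PosNum e0).
Unshelve. all: by end_near. Qed.

Lemma measurable_lattice_index n k (z : 'rV[int]_n) :
  measurable [set x : rVm n | lattice_index k x = z].
Proof.
pose A j : set (rVm n) := (fun x => x 0 j) @^-1`
  [set r : R | (z 0 j)%:~R <= r * k.+1%:R /\ r * k.+1%:R < (z 0 j + 1)%:~R].
rewrite (_ : [set _ | _] = \bigcap_(j in [set: 'I_n]) A j).
  apply: fin_bigcap_measurable => [//|j _].
  rewrite -[X in measurable X]setTI; apply: measurable_rV_coord => //.
  have mk : measurable_fun setT (fun r : R => r * k.+1%:R) by exact: mulrr_measurable.
  have := mk measurableT _ (measurable_itv `[(z 0 j)%:~R, (z 0 j + 1)%:~R[).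
  rewrite setTI; congr (measurable _); apply/seteqP; split => r /=; rewrite in_itv/=.
    by move=> /andP.
  by move=> [-> ->].
apply/seteqP; split => x /=.
  move=> xz j _; rewrite /A /= -xz !mxE; split; first exact: ge_floor.
  exact: floorD1_gt.
move=> Ax; apply/rowP => j; rewrite mxE; have [h1 h2] := Ax j Logic.I.
by apply/eqP; rewrite floor_eq h1.
Qed.

(** Round the vector to a lattice, which has countably many points, and refine
    the lattice: by continuity the rounded functions converge. *)
Lemma measurable_caratheodory d (T : measurableType d) d' (Y : measurableType d')
    n (f : 'rV[R]_n -> Y -> R) (g : T -> rVm n) (h : T -> Y) :
  (forall y, continuous (f ^~ y)) -> (forall x, measurable_fun setT (f x)) ->
  measurable_fun setT g -> measurable_fun setT h ->
  measurable_fun setT (fun t => f (g t) (h t)).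
Proof.
move=> cf mf mg mh.
apply: (@measurable_fun_cvg _ _ _ _
  (fun k t => f (lattice_point k (lattice_index k (g t))) (h t))) => [k|t _].
  move=> _ B mB; rewrite setTI.
  rewrite (_ : _ @^-1` B = \bigcup_(z in [set: 'rV[int]_n])
      ((g @^-1` [set x | lattice_index k x = z]) `&`
       ((f (lattice_point k z) \o h) @^-1` B))).
    apply: countable_bigcupT_measurable => [|z]; first exact: countableP.
    apply: measurableI.
      rewrite -[X in measurable X]setTI; apply: mg => //.
      exact: measurable_lattice_index.
    rewrite -[X in measurable X]setTI.
    exact: (measurableT_comp (mf _) mh).
  apply/seteqP; split => t /=; first by move=> Bt; exists (lattice_index k (g t)).
  by move=> [z _ [/= <-]].
exact: (cvg_comp _ _ (@cvg_lattice_point _ (g t)) (cf (h t) (g t))).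
Qed.

Lemma mixed_smooth_comp m n (f : Omega_ R n -> 'rV[R]_1)
    (g : Omega_ R m -> 'rV[R]_n) (Phi : Omega R -> Omega R) :
  mixed_smooth f -> mixed_smooth g -> measurable_fun setT Phi ->
  mixed_smooth (fun x => f (g x, Phi x.2)).
Proof.
move=> [sf mf] [sg mg] mPhi; split=> [w|t].
  exact: (Cinfty_comp (sf (Phi w)) (sg w)).
apply: measurable_to_rV1.
apply: (@measurable_caratheodory _ _ _ _ _ (fun x w => f (x, w) 0 0)) => //.
- move=> w x; apply: (@continuous_comp _ _ _ (fun x => f (x, w)) (fun M => M 0 0)).
    exact: (sf w 0%N).
  exact: coord_continuous.
- by move=> x; exact: (measurableT_comp (@measurable_rV_coord 1 0) (mf x)).
Qed.

Lemma euclidean1_sss : sample_smooth (euclidean R 1).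
Proof.
split=> [n c|m n p h sp [g [Phi [sg mPhi ->]]]].
  split=> [w k|t]; first exact: Ck_cst.
  exact: measurable_cst.
exact: (mixed_smooth_comp sp sg mPhi).
Qed.

End caratheodory_functions.

(** * Plots and laws of samples *)

Section plots.
Context (R : realType).
Local Notation Om := (Omega R).
Local Notation U := (unif R).
Implicit Types X Y : sss R.

Lemma mixed_smooth_fst n : mixed_smooth (fst : Omega_ R n -> 'rV[R]_n).
Proof.
split=> [w|t]; last exact: measurable_cst.
case=> [|k]; first by move=> t; exact: cvg_id.
split=> [t|v]; first exact: ex_diff.
suff -> : (fun t => 'D_v id t) = (fun=> v : 'rV[R]_n) by exact: Ck_cst.
by apply/funext => t; exact: derive_id.
Qed.

Lemma mixed_smooth_cst m n (c : 'rV[R]_n) :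
  mixed_smooth (fun _ : Omega_ R m => c).
Proof. by split=> [w k|t]; [exact: Ck_cst|exact: measurable_cst]. Qed.

Lemma mixed_smooth_reparam m n (g : Omega_ R m -> 'rV[R]_n) (Phi : Om -> Om) :
  mixed_smooth g -> measurable_fun setT Phi ->
  mixed_smooth (fun a => g (a.1, Phi a.2)).
Proof.
move=> [sg mg] mPhi; split=> [w|t]; first exact: (sg (Phi w)).
exact: (measurableT_comp (mg t) mPhi).
Qed.

Lemma plots_comp X m n (p : Omega_ R n -> X) (g : Omega_ R m -> 'rV[R]_n)
    (Phi : Om -> Om) :
  plots X n p -> mixed_smooth g -> measurable_fun setT Phi ->
  plots X m (fun a => p (g a, Phi a.2)).
Proof.
move=> pp sg mPhi; apply: ((sssP X).2 _ _ _ (fun a => (g a, Phi a.2)) pp).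
by exists g, Phi.
Qed.

Lemma plots_reparam X n (p : Omega_ R n -> X) (Phi : Om -> Om) :
  plots X n p -> measurable_fun setT Phi ->
  plots X n (fun a => p (a.1, Phi a.2)).
Proof. by move=> pp; apply: plots_comp => //; exact: mixed_smooth_fst. Qed.

Lemma plots_samples X n (p : Omega_ R n -> X) t (Phi : Om -> Om) :
  plots X n p -> measurable_fun setT Phi -> samples (fun w => p (t, Phi w)).
Proof.
move=> pp mPhi.
exact: (@plots_comp X 0 n p (fun=> t) Phi pp (mixed_smooth_cst 0 t) mPhi).
Qed.

Lemma samples_plots X n (x : Om -> X) (Phi : Om -> Om) :
  samples x -> measurable_fun setT Phi -> plots X n (fun a => x (Phi a.2)).
Proof.
move=> sx mPhi.
exact: (@plots_comp X n 0 (fun a => x a.2) (fun=> 0) Phi sx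
  (mixed_smooth_cst n 0) mPhi).
Qed.

Lemma samples_reparam X (x : Om -> X) (Phi : Om -> Om) :
  samples x -> measurable_fun setT Phi -> samples (x \o Phi).
Proof. exact: samples_plots. Qed.

Lemma samples_cst X (c : X) : samples (fun=> c).
Proof. exact: (sssP X).1. Qed.

Lemma samples_map (X Y : plot_space R) (f : X -> Y) (x : Om -> X) :
  is_smooth f -> samples x -> samples (f \o x).
Proof. by move=> sf; exact: sf. Qed.

Lemma law_eq (X : plot_space R) (P Q : set Om -> \bar R) (x y : Om -> X) :
  (forall A, induced_sigma A -> P (x @^-1` A) = Q (y @^-1` A)) ->
  law P x = law Q y.
Proof.
move=> xy; apply/funext => A; rewrite /law !patchE.
by case: ifPn => // /set_mem; exact: xy.
Qed.

Lemma lawE (X : plot_space R) (P : set Om -> \bar R) (x : Om -> X) A :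
  induced_sigma A -> law P x A = P (x @^-1` A).
Proof. by move=> mA; rewrite /law patchE mem_set. Qed.

Lemma law_reindex (X : plot_space R) (x : Om -> X) (s s' : nat -> nat) :
  samples x -> cancel s s' -> law U (fun w => x (w \o s)) = law U x.
Proof. by move=> sx sK; apply: law_eq => A mA; apply: (unif_reindex sK); exact: mA. Qed.

(** A natural transformation [r] of sequences is reindexing along its value at
    the identity sequence of indices; an index sequence that [r] sends to the
    identity is a left inverse of that map. *)
Lemma law_rearrange (X : plot_space R) (x : Om -> X)
    (r : forall T, (nat -> T) -> nat -> T) (s' : nat -> nat) :
  (forall T T' (f : T -> T') s, f \o r T s = r T' (f \o s)) ->
  r nat s' = id ->
  samples x -> law U (fun w => x (r _ w)) = law U x.
Proof.
move=> r_nat rs' sx.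
rewrite (_ : (fun w => _) = fun w => x (w \o r nat id)).
  apply: (law_reindex (s' := s')) => // n.
  by rewrite -[LHS]/((s' \o r nat id) n) r_nat rs'.
by apply/funext => w; rewrite r_nat.
Qed.

Lemma law_theta1 (X : plot_space R) (x : Om -> X) :
  samples x -> law U (fun w => x (theta1 w)) = law U x.
Proof. by move=> sx; exact: (law_reindex sx doubleK). Qed.

Lemma law_theta2 (X : plot_space R) (x : Om -> X) :
  samples x -> law U (fun w => x (theta2 w)) = law U x.
Proof.
move=> sx; apply: (law_reindex (s := fun n => n.*2.+1) (s' := half) sx) => n.
by rewrite /= uphalf_double.
Qed.

Lemma law_cst (X : plot_space R) (c : X) (P : probability Om R) : law P (fun=> c) = dirac_law c.
Proof.
apply/funext => A; rewrite /law /dirac_law !patchE; case: ifPn => // _.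
rewrite indicE; have [Ac|nAc] := pselect (A c).
  by rewrite mem_set// -(probability_setT P); congr (P _); apply/seteqP; split.
rewrite memNset//; transitivity (P set0); last by rewrite measure0.
by congr (P _); apply/seteqP; split.
Qed.

Lemma pushm_law (X Y : plot_space R) (f : X -> Y) (P : set Om -> \bar R)
    (x : Om -> X) :
  is_smooth f -> pushm f (law P x) = law P (f \o x).
Proof.
move=> sf; apply/funext => A; rewrite /pushm /law !patchE.
case: ifPn => // /set_mem mA; rewrite mem_set// => y sy.
exact: (mA (f \o y) (samples_map sf sy)).
Qed.

End plots.

(** * The probability monad *)

Section prob_space.
Context (R : realType).
Local Notation Om := (Omega R).
Local Notation U := (unif R).
Implicit Types X Y : sss R.

Lemma Prob_eq (X : plot_space R) (mu nu : Prob X) : sval mu = sval nu -> mu = nu.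
Proof. by case: mu nu => [m ?] [n ?] /= mn; exact: eq_exist. Qed.

Lemma is_prob_law (X : plot_space R) (x : Om -> X) : samples x -> is_prob (law U x).
Proof. by move=> sx; exists x, U. Qed.

Definition sample_prob (X : plot_space R) (x : Om -> X) (sx : samples x) : Prob X :=
  exist _ (law U x) (is_prob_law sx).

(** Laws under arbitrary probabilities are laws under [unif]: a sample absorbs
    the map that simulates its probability. *)
Lemma is_prob_unif X (mu : set X -> \bar R) : is_prob mu ->
  exists2 x, samples x & mu = law U x.
Proof.
move=> [x [P [sx ->]]]; have [f mf Pf] := um_sampler P.
exists (x \o f); first exact: samples_reparam.
by apply: law_eq => A mA; rewrite Pf//; exact: mA.
Qed.

Lemma Prob_unif X (mu : Prob X) : exists2 x, samples x & sval mu = law U x.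
Proof. exact: is_prob_unif (proj2_sig mu). Qed.

Lemma Prob_sss X : sample_smooth (Prob X).
Proof.
split=> [n mu|m n p h [Y pY pE] [g [Phi [sg mPhi ->]]]].
  have [x sx muE] := Prob_unif mu.
  (* A constant law ignores the half of the randomness that it is given. *)
  exists (fun a => x (theta2 a.2)).
    exact: samples_plots (@measurable_theta2 R).
  move=> t w; rewrite muE; congr (law U _).
  by apply/funext => w'; rewrite theta2V.
(* The first half of the randomness drives the reparametrisation, the second
   half remains the internal randomness of the plot of laws. *)
pose Psi (w : Om) : Om := thetaV (Phi (theta1 w)) (theta2 w).
have m1 := @measurable_theta1 R; have m2 := @measurable_theta2 R.
exists (fun a => Y (g (a.1, theta1 a.2), Psi a.2)).
  apply: (plots_comp (g := fun a => g (a.1, theta1 a.2))) => //.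
    exact: mixed_smooth_reparam.
  by apply: measurable_thetaV => //; exact: measurableT_comp.
move=> t w; rewrite /= pE; congr (law U _); apply/funext => w'.
by rewrite /Psi !theta1V theta2V.
Qed.

Definition prob_obj (X : SSScat R) : SSScat R := SSS (@Prob_sss X).

(** A random probability is the conditional law of a sample given the first
    half of the randomness. *)
Definition conditional_law X (x : Om -> X) (G : Om -> Prob X) : Prop :=
  forall w, sval (G w) = law U (fun w' => x (thetaV w w')).

Lemma samples_ProbP X (G : Om -> Prob X) :
  samples G -> exists2 x, samples x & conditional_law x G.
Proof.
move=> [Y pY YE]; exists (fun w => Y (0, w)).
  exact: (plots_samples 0 pY (@measurable_id _ _ setT)).
by move=> w; rewrite (YE 0 w).
Qed.

Lemma conditional_law_samples X (x : Om -> X) (G : Om -> Prob X) :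
  samples x -> conditional_law x G -> samples G.
Proof. by move=> sx GE; exists (fun a => x a.2) => // t w; rewrite GE. Qed.

Lemma conditional_lawE X (x : Om -> X) (G : Om -> Prob X) A w :
  conditional_law x G -> induced_sigma A ->
  sval (G w) A = U (section (x @^-1` A) w).
Proof. by move=> -> mA; rewrite lawE. Qed.

Lemma sigma_spaceP (X : plot_space R) (q : X) (A : set X) :
  measurable (A : set (sigma_space q)) <-> induced_sigma A.
Proof. by []. Qed.

(** Evaluation at [A] is measurable because along a random probability it is
    the measure of the sections of one universally measurable set. *)
Lemma induced_sigma_eval X (A : set X) : induced_sigma A ->
  forall q : Prob X,
  measurable_fun setT ((fun nu : Prob X => sval nu A) : sigma_space q -> \bar R).
Proof.
move=> mA q _ B mB; rewrite setTI; apply/sigma_spaceP => G sG.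
have [x sx GE] := samples_ProbP sG.
have := measurable_unif_section (mA x sx).
move=> /(_ measurableT B mB); rewrite setTI.
by congr (measurable _); apply/seteqP; split => w /=; rewrite (conditional_lawE w GE mA).
Qed.

Section integral_law.
Context (X : plot_space R) (q : X) (P : probability Om R) (x : Om -> X).
Hypothesis sx : samples x.
Let S := sigma_space q.

Let measurable_sample : @measurable_fun _ _ Om S setT x.
Proof. by move=> _ A /sigma_spaceP mA; rewrite setTI; exact: mA. Qed.

Let sample : {mfun Om >-> S} :=
  @mfun_Sub _ _ Om S x (mem_set measurable_sample).

Let law_S : set S -> \bar R := law P x.

Let law_S0 : law_S set0 = 0%E.
Proof. by rewrite /law_S lawE ?measure0//; exact: (@induced_sigma0 _ X). Qed.

Let law_S_ge0 A : (0 <= law_S A)%E.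
Proof. by rewrite /law_S /law patchE; case: ifP. Qed.

Let law_S_additive : semi_sigma_additive law_S.
Proof.
move=> F mF tF mUF; rewrite /law_S lawE//.
rewrite (_ : (fun n => _) = fun n => (\sum_(0 <= i < n) P (x @^-1` F i))%E).
  exact: (@measure_semi_sigma_additive _ S R (distribution P sample) F mF tF mUF).
by apply/funext => n; apply: eq_bigr => i _; rewrite lawE//; exact: mF.
Qed.

HB.instance Definition _ := isMeasure.Build _ S R law_S
  law_S0 law_S_ge0 law_S_additive.

Lemma integral_law (f : X -> \bar R) :
  @measurable_fun _ _ S (\bar R) setT f -> (forall z, 0 <= f z)%E ->
  (\int[law P x : set S -> \bar R]_z f z = \int[P]_w f (x w))%E.
Proof.
move=> mf f0.
rewrite -[LHS]/(\int[law_S]_z f z)%E.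
rewrite (eq_measure_integral (distribution P sample)); last first.
  by move=> A mA _; rewrite /= /law_S lawE.
by rewrite (ge0_integral_pushforward measurable_sample).
Qed.

End integral_law.

(** Averaging conditional laws over the first half of the randomness is
    Fubini's theorem along [thetaV]. *)
Lemma barycenter_law X (x : Om -> X) (G : Om -> Prob X) :
  samples x -> conditional_law x G -> barycenter (law U G) = law U x.
Proof.
move=> sx GE; apply/funext => A; rewrite /barycenter [RHS]/law !patchE.
case: ifPn => // /set_mem mA; rewrite /integral_on.
case: pselect => [h|nP]; last by exfalso; apply: nP; exists (G point).
rewrite (integral_law _ (conditional_law_samples sx GE)).
- rewrite -(unif_fubini (mA x sx)); apply: eq_integral => w _.
  exact: conditional_lawE.
- exact: induced_sigma_eval.
- move=> nu; have [y sy ->] := Prob_unif nu.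
  by rewrite lawE.
Qed.

Lemma is_prob_pushm X Y (f : X -> Y) (mu : set X -> \bar R) :
  is_smooth f -> is_prob mu -> is_prob (pushm f mu).
Proof.
move=> sf [x [P [sx ->]]]; exists (f \o x), P; split.
  exact: samples_map sf sx.
exact: pushm_law.
Qed.

Definition prob_map X Y (f : smap X Y) (mu : Prob X) : Prob Y :=
  exist _ (pushm (sval f) (sval mu))
    (is_prob_pushm (proj2_sig f) (proj2_sig mu)).

Lemma prob_map_smooth X Y (f : smap X Y) : is_smooth (prob_map f).
Proof.
move=> n p [y py pE]; exists (sval f \o y); first exact: (proj2_sig f).
by move=> t w; rewrite /= pE pushm_law//; exact: proj2_sig f.
Qed.

Lemma is_prob_dirac X (c : X) : is_prob (dirac_law c).
Proof. by exists (fun=> c), U; split; [exact: samples_cst|rewrite law_cst]. Qed.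

Definition dirac_prob X (c : X) : Prob X := exist _ (dirac_law c) (is_prob_dirac c).

Lemma dirac_prob_smooth X : is_smooth (@dirac_prob X).
Proof.
move=> n p pp; exists (fun a => p (a.1, theta1 a.2)).
  exact: plots_reparam (@measurable_theta1 R).
move=> t w /=; rewrite -(law_cst (p (t, w)) U); congr (law U _).
by apply/funext => w'; rewrite theta1V.
Qed.

(** Three streams grouped as [(a, (b, c))] are regrouped as [((a, b), c)]: a
    draw of [b] given [a] followed by a draw of [c] given [(a, b)] is one draw
    of [(b, c)] given [a]. *)
Definition assoc_seq T (s : nat -> T) : nat -> T :=
  interleave (interleave (evens s) (evens (odds s))) (odds (odds s)).

Lemma assoc_seq_nat T T' (f : T -> T') (s : nat -> T) :
  f \o assoc_seq s = assoc_seq (f \o s).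
Proof. by rewrite /assoc_seq !comp_interleave. Qed.

Lemma measurable_assoc_seq : measurable_fun setT (@assoc_seq {i01 R} : Om -> Om).
Proof.
have m1 := @measurable_theta1 R; have m2 := @measurable_theta2 R.
apply: (measurable_thetaV (f := fun w => thetaV (theta1 w) (theta1 (theta2 w)))
  (g := fun w => theta2 (theta2 w))).
  by apply: measurable_thetaV => //; exact: measurableT_comp.
exact: measurableT_comp.
Qed.

Lemma law_assoc_seq X (x : Om -> X) : samples x ->
  law U (fun w => x (assoc_seq w)) = law U x.
Proof.
apply: (law_rearrange (r := assoc_seq) (s' := interleave (evens (evens id))
  (interleave (odds (evens id)) (odds id))) assoc_seq_nat).
rewrite /assoc_seq !(evens_interleave, odds_interleave).
by rewrite !interleaveK.
Qed.

Lemma is_prob_barycenter X (Gamma : Prob (Prob X)) : is_prob (barycenter (sval Gamma)).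
Proof.
have [G sG ->] := @Prob_unif (SSS (Prob_sss X)) Gamma.
have [x sx GE] := samples_ProbP sG.
by rewrite (barycenter_law sx GE); exact: is_prob_law.
Qed.

Definition bary X (Gamma : Prob (Prob X)) : Prob X :=
  exist _ (barycenter (sval Gamma)) (is_prob_barycenter Gamma).

Lemma bary_smooth X : is_smooth (@bary X).
Proof.
move=> n p [G [Y pY YE] GE]; exists (fun a => Y (a.1, assoc_seq a.2)).
  exact: plots_reparam measurable_assoc_seq.
move=> t w /=; rewrite GE.
apply: (@barycenter_law X (fun w' => Y (t, assoc_seq (thetaV w w')))).
  apply: (plots_samples t pY (Phi := fun w' => assoc_seq (thetaV w w'))).
  exact: (measurableT_comp measurable_assoc_seq (measurable_thetaV2 w)).
move=> w'; rewrite YE; congr (law U _); apply/funext => w''; congr (Y (t, _)).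
by rewrite /assoc_seq (evens_interleave w) !(odds_interleave w) evens_interleave
  odds_interleave.
Qed.

End prob_space.

Section probability_monad.
Context (R : realType).
Local Notation Om := (Omega R).
Local Notation U := (unif R).
Local Notation P := (@prob_obj R).
Local Notation S := (SSScat R).

Definition prob_arr (X Y : S) (f : Arr X Y) : Arr (P X) (P Y) :=
  exist _ (prob_map f) (@prob_map_smooth R X Y f).

Definition dirac_arr (X : S) : Arr X (P X) :=
  exist _ (@dirac_prob R X) (@dirac_prob_smooth R X).

Definition bary_arr (X : S) : Arr (P (P X)) (P X) :=
  exist _ (@bary R X) (@bary_smooth R X).

Lemma arr_smooth (X Y : S) (f : Arr X Y) : is_smooth (sval f).
Proof. exact: (proj2_sig f). Qed.

Lemma prob_arr_id (X : S) : prob_arr (idm X) = idm (P X).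
Proof.
apply: smap_eq; apply/funext => mu; apply: Prob_eq => /=.
by have [x sx ->] := Prob_unif mu; rewrite pushm_law.
Qed.

Lemma prob_arr_cmp (X Y Z : S) (g : Arr Y Z) (f : Arr X Y) :
  prob_arr (g ∘ f) = prob_arr g ∘ prob_arr f.
Proof.
apply: smap_eq; apply/funext => mu; apply: Prob_eq => /=.
have [x sx ->] := Prob_unif mu; rewrite !pushm_law//; try exact: arr_smooth.
exact: (arr_smooth (g ∘ f)).
Qed.

Lemma dirac_arr_nat (X Y : S) (f : Arr X Y) :
  prob_arr f ∘ dirac_arr X = dirac_arr Y ∘ f.
Proof.
apply: smap_eq; apply/funext => c; apply: Prob_eq => /=.
by rewrite -!(law_cst _ U) pushm_law//; exact: arr_smooth.
Qed.

Lemma prob_prob_unif (X : S) (Gamma : P (P X)) :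
  exists2 G, sval Gamma = law U G & exists2 x, samples x & conditional_law x G.
Proof. by have [G sG ->] := Prob_unif Gamma; exists G => //; exact: samples_ProbP. Qed.

Lemma bary_arr_nat (X Y : S) (f : Arr X Y) :
  prob_arr f ∘ bary_arr X = bary_arr Y ∘ prob_arr (prob_arr f).
Proof.
apply: smap_eq; apply/funext => Gamma; apply: Prob_eq => /=.
have [G -> [x sx GE]] := prob_prob_unif Gamma.
rewrite pushm_law; last exact: (arr_smooth (prob_arr f)).
rewrite (barycenter_law sx GE) pushm_law; last exact: arr_smooth.
rewrite (@barycenter_law _ _ (sval f \o x))//.
  exact: samples_map (arr_smooth f) sx.
by move=> w /=; rewrite GE pushm_law//; exact: arr_smooth.
Qed.

Lemma bary_dirac (X : S) : bary_arr X ∘ dirac_arr (P X) = idm (P X).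
Proof.
apply: smap_eq; apply/funext => mu; apply: Prob_eq => /=.
have [x sx muE] := Prob_unif mu; rewrite -(law_cst _ U).
rewrite (@barycenter_law _ _ (fun w => x (theta2 w))) ?law_theta2//.
  exact: samples_reparam (@measurable_theta2 R).
by move=> w; rewrite muE; congr (law U _); apply/funext => w'; rewrite theta2V.
Qed.

Lemma bary_prob_dirac (X : S) : bary_arr X ∘ prob_arr (dirac_arr X) = idm (P X).
Proof.
apply: smap_eq; apply/funext => mu; apply: Prob_eq => /=.
have [x sx ->] := Prob_unif mu; rewrite pushm_law; last exact: (arr_smooth (dirac_arr X)).
rewrite (@barycenter_law _ _ (fun w => x (theta1 w))) ?law_theta1//.
  exact: samples_reparam (@measurable_theta1 R).
move=> w /=; rewrite -(law_cst _ U); congr (law U _).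
by apply/funext => w'; rewrite theta1V.
Qed.

Lemma bary_bary (X : S) :
  bary_arr X ∘ prob_arr (bary_arr X) = bary_arr X ∘ bary_arr (P X).
Proof.
apply: smap_eq; apply/funext => Gamma; apply: Prob_eq => /=.
have [H -> [G sG HE]] := prob_prob_unif Gamma.
have [x sx GE] := samples_ProbP sG.
rewrite pushm_law; last exact: (arr_smooth (bary_arr X)).
rewrite (barycenter_law sG HE) (barycenter_law sx GE).
rewrite (@barycenter_law _ _ (fun w => x (assoc_seq w))) ?law_assoc_seq//.
  exact: samples_reparam (@measurable_assoc_seq R).
move=> w /=; rewrite HE.
rewrite (@barycenter_law _ X (fun w' => x (assoc_seq (thetaV w w'))))//.
  apply: (samples_reparam (Phi := fun w' => assoc_seq (thetaV w w')) sx).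
  exact: (measurableT_comp (@measurable_assoc_seq R) (measurable_thetaV2 w)).
move=> w'; rewrite GE; congr (law U _); apply/funext => w''; congr x.
by rewrite /assoc_seq (evens_interleave w) !(odds_interleave w) evens_interleave
  odds_interleave.
Qed.

Definition prob_monad : monad P :=
  @Monad S P prob_arr dirac_arr bary_arr prob_arr_id prob_arr_cmp dirac_arr_nat
    bary_arr_nat bary_dirac bary_prob_dirac bary_bary.

End probability_monad.

(** * Independent products of laws *)

Section product_laws.
Context (R : realType).
Local Notation Om := (Omega R).
Local Notation U := (unif R).
Implicit Types X Y : sss R.

Lemma samples_pair X Y (x : Om -> X) (y : Om -> Y) :
  samples x -> samples y -> @samples R (prod_space X Y) (fun w => (x w, y w)).
Proof. by []. Qed.

Definition indep_pair X Y (x : Om -> X) (y : Om -> Y) : Om -> prod_space X Y :=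
  fun w => (x (theta1 w), y (theta2 w)).

Lemma samples_indep_pair X Y (x : Om -> X) (y : Om -> Y) :
  samples x -> samples y -> samples (indep_pair x y).
Proof.
move=> sx sy; apply: samples_pair.
  exact: (samples_reparam sx (@measurable_theta1 R)).
exact: (samples_reparam sy (@measurable_theta2 R)).
Qed.

Let induced_slice X Y (C : set (prod_space X Y)) (c : X) :
  induced_sigma C -> @induced_sigma R Y [set z | C (c, z)].
Proof.
by move=> mC y sy; exact: (mC _ (samples_pair (samples_cst c) sy)).
Qed.

Let integral_slice X Y (y : Om -> Y) (C : set (prod_space X Y)) (c : X) :
  samples y -> induced_sigma C ->
  (\int[U]_w2 (\1_C (c, y w2))%:E)%E = U (y @^-1` [set z | C (c, z)]).
Proof.
move=> sy mC; have mD := induced_slice c mC sy.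
by rewrite -[in RHS](setIT (_ @^-1` _)) -integral_indic.
Qed.

Lemma indep_lawE X Y (x : Om -> X) (y : Om -> Y) : samples x -> samples y ->
  indep_law x y = law U (indep_pair x y).
Proof.
move=> sx sy; apply/funext => C; rewrite /indep_law /law !patchE.
case: ifPn => // /set_mem mC.
rewrite -unif_fubini; last exact: (mC _ (samples_indep_pair sx sy)).
apply: eq_integral => w _; rewrite integral_slice//; congr (U _).
by apply/seteqP; split => w' /=; rewrite /section /indep_pair /= theta1V theta2V.
Qed.

Definition swap_seq T (s : nat -> T) : nat -> T := interleave (odds s) (evens s).

Lemma law_swap_seq (X : plot_space R) (x : Om -> X) : samples x ->
  law U (fun w => x (swap_seq w)) = law U x.
Proof.
apply: (law_rearrange (r := swap_seq) (s' := swap_seq id)).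
  by move=> T T' f s; rewrite /swap_seq comp_interleave.
by rewrite /swap_seq evens_interleave odds_interleave interleaveK.
Qed.

Lemma law_indep_swap X Y (x : Om -> X) (y : Om -> Y) : samples x -> samples y ->
  law U (indep_pair y x) = pushm (sval (swap_map X Y)) (law U (indep_pair x y)).
Proof.
move=> sx sy; rewrite -(law_swap_seq (samples_indep_pair sy sx)) pushm_law//.
  congr (law U _); apply/funext => w; rewrite /indep_pair /=.
  by congr (y _, x _); [exact: evens_interleave|exact: odds_interleave].
exact: (proj2_sig (swap_map X Y)).
Qed.

(* With the first point fixed, the inner integral is the law of the second
   sample evaluated on a slice. *)
Let indep_law_eqr X Y (x : Om -> X) (y y' : Om -> Y) :
  samples x -> samples y -> samples y' -> law U y = law U y' ->
  indep_law x y = indep_law x y'.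
Proof.
move=> sx sy sy' yy'; apply/funext => C; rewrite /indep_law !patchE.
case: ifPn => // /set_mem mC; apply: eq_integral => w _.
have mD := induced_slice (x w) mC.
by rewrite !integral_slice// -(lawE U y mD) yy' lawE.
Qed.

(** The second sample enters only through its law on slices; exchanging the two
    halves of the randomness gives the same for the first sample. *)
Lemma indep_law_eq X Y (x x' : Om -> X) (y y' : Om -> Y) :
  samples x -> samples x' -> samples y -> samples y' ->
  law U x = law U x' -> law U y = law U y' ->
  indep_law x y = indep_law x' y'.
Proof.
move=> sx sx' sy sy' xx' yy'; rewrite (indep_law_eqr sx sy sy' yy').
rewrite !indep_lawE// law_indep_swap// -indep_lawE// (indep_law_eqr sy' sx sx' xx').
by rewrite indep_lawE// -law_indep_swap.
Qed.

Lemma prod_law_unif X Y (x : Om -> X) (y : Om -> Y) : samples x -> samples y ->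
  prod_law (law U x) (law U y) = law U (indep_pair x y).
Proof.
move=> sx sy; rewrite -indep_lawE// /prod_law.
set E := [set pi | _].
have [|x' [y' [sx' sy' xx' yy' ->]]] := @xgetPex _ (fun=> 0%E) E.
  by exists (indep_law x y), x, y.
exact: indep_law_eq.
Qed.

Lemma prod_law_dirac X Y (x : X) (y : Y) :
  prod_law (dirac_law x) (dirac_law y) = @dirac_law R (prod_space X Y) (x, y).
Proof.
rewrite -(law_cst x U) -(law_cst y U) -(law_cst ((x, y) : prod_space X Y) U).
by rewrite prod_law_unif//; exact: samples_cst.
Qed.

Lemma is_prob_prod X Y (mu : set X -> \bar R) (nu : set Y -> \bar R) :
  is_prob mu -> is_prob nu -> is_prob (prod_law mu nu).
Proof.
move=> /is_prob_unif[x sx ->] /is_prob_unif[y sy ->].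
by rewrite prod_law_unif//; apply: is_prob_law; exact: samples_indep_pair.
Qed.

End product_laws.

(** * Kleisli composition *)

Section kleisli_pure.
Context (C : category) (T : C -> C) (M : monad T).

Lemma kl_incl_post (A B D : C) (f : Arr B D) (K : Arr A (T B)) :
  @cmp (kleisli M) A B D (funmap (kl_incl M) f) K = tmap M f ∘ K.
Proof. by rewrite /= /kl_cmp /kl_incl_map tmap_cmp cmpA mult_etar cmp_idl. Qed.

Lemma kl_incl_pre (A B D : C) (L : Arr B (T D)) (f : Arr A B) :
  @cmp (kleisli M) A B D L (funmap (kl_incl M) f) = L ∘ f.
Proof.
rewrite /= /kl_cmp /kl_incl_map cmpA -[mult _ _ ∘ _ ∘ _]cmpA eta_nat.
by rewrite cmpA mult_etal cmp_idl.
Qed.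

End kleisli_pure.

Section markov_cartesian.
Context (C : category) (ox : C -> C -> C) (I : C) (M : markov_category ox I).

(** In a cartesian Markov category both ways of copying the output of a
    morphism have that morphism as marginals, hence they agree. *)
Lemma cartesian_copy_natural : cartesian M -> copy_natural M.
Proof.
move=> [_ cart] A B f; have [h [_ hP]] := cart _ _ _ f f.
rewrite /deterministic -(hP (copy M B ∘ f)); last first.
  by rewrite /marginal1 /marginal2 !cmpA copy_delr copy_dell !cmp_idl.
apply: hP; rewrite /marginal1 /marginal2; split.
  rewrite cmpA -[_ ∘ tens M f f]cmpA -tens_cmp cmp_idl del_nat.
  have -> : tens M f (del M A) = tens M f (idm I) ∘ tens M (idm A) (del M A).
    by rewrite -tens_cmp cmp_idr cmp_idl.
  by rewrite cmpA runit_nat -!cmpA [runit _ _ ∘ _]cmpA copy_delr cmp_idr.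
rewrite cmpA -[_ ∘ tens M f f]cmpA -tens_cmp cmp_idl del_nat.
have -> : tens M (del M A) f = tens M (idm I) f ∘ tens M (del M A) (idm A).
  by rewrite -tens_cmp cmp_idr cmp_idl.
by rewrite cmpA lunit_nat -!cmpA [lunit _ _ ∘ _]cmpA copy_dell cmp_idr.
Qed.

End markov_cartesian.

Section kleisli_laws.
Context (R : realType).
Local Notation Om := (Omega R).
Local Notation U := (unif R).
Local Notation P := (@prob_obj R).
Local Notation S := (SSScat R).
Local Notation T := (@prob_monad R).
Local Notation Kl := (kleisli T).
Local Notation pure := (funmap (kl_incl T)).

Lemma kl_eq (X Y : S) (K L : @Arr Kl X Y) :
  (forall x, sval (sval K x) = sval (sval L x)) -> K = L.
Proof. by move=> KL; apply: smap_eq; apply/funext => x; apply: Prob_eq. Qed.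

Lemma kl_idE (X : S) : @idm Kl X = pure (idm X).
Proof. by rewrite fmap_id. Qed.

Lemma pure_post (X Y Z : S) (f : Arr Y Z) (K : @Arr Kl X Y) x :
  sval (sval (pure f ∘ K) x) = pushm (sval f) (sval (sval K x)).
Proof. by rewrite kl_incl_post. Qed.

Lemma pure_pre (X Y Z : S) (L : @Arr Kl Y Z) (f : Arr X Y) x :
  sval (sval (L ∘ pure f) x) = sval (sval L (sval f x)).
Proof. by rewrite kl_incl_pre. Qed.

(** To compose, draw a sample of the first morphism with the first half of the
    randomness and spend the second half on the second morphism. *)
Lemma kl_cmp_law (X Y Z : S) (L : @Arr Kl Y Z) (K : @Arr Kl X Y) x
    (a : Om -> Y) (G : Om -> Z) :
  samples a -> samples G -> sval (sval K x) = law U a ->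
  conditional_law G (sval L \o a) -> sval (sval (L ∘ K) x) = law U G.
Proof.
move=> sa sG Ka LG /=; rewrite Ka pushm_law; last exact: (proj2_sig L).
exact: barycenter_law.
Qed.

Lemma kl_cond (Y Z : S) (L : @Arr Kl Y Z) (a : Om -> Y) : samples a ->
  exists2 G, samples G & conditional_law G (sval L \o a).
Proof. by move=> sa; apply: samples_ProbP; exact: (samples_map (proj2_sig L)). Qed.

End kleisli_laws.

(** * The Markov category *)

Section space_maps.
Context (R : realType).
Local Notation S := (SSScat R).

Definition prod_arr (X X' Y Y' : S) (f : Arr X X') (g : Arr Y Y') :
    Arr (prod_obj X Y) (prod_obj X' Y') :=
  exist (@is_smooth R (prod_space X Y) (prod_space X' Y'))
    (fun a => (sval f a.1, sval g a.2))
    (fun n p pp => conj (proj2_sig f _ _ (proj1 pp)) (proj2_sig g _ _ (proj2 pp))).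

Definition assocV_map (X Y Z : S) :
    Arr (prod_obj X (prod_obj Y Z)) (prod_obj (prod_obj X Y) Z) :=
  exist (@is_smooth R (prod_space X (prod_space Y Z))
           (prod_space (prod_space X Y) Z))
    (fun a => ((a.1, a.2.1), a.2.2))
    (fun _ _ pp => conj (conj (proj1 pp) (proj1 (proj2 pp))) (proj2 (proj2 pp))).

Definition lunitV_map (X : S) : Arr X (prod_obj (one_obj R) X) :=
  exist (@is_smooth R X (prod_space (one_space R) X)) (fun x => (tt, x))
    (fun _ _ pp => conj Logic.I pp).

Definition runitV_map (X : S) : Arr X (prod_obj X (one_obj R)) :=
  exist (@is_smooth R X (prod_space X (one_space R))) (fun x => (x, tt))
    (fun _ _ pp => conj pp Logic.I).

End space_maps.

Section markov.
Context (R : realType).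
Local Notation Om := (Omega R).
Local Notation U := (unif R).
Local Notation P := (@prob_obj R).
Local Notation S := (SSScat R).
Local Notation T := (@prob_monad R).
Local Notation Kl := (kleisli T).
Local Notation pure := (funmap (kl_incl T)).
Local Notation one := (one_obj R).
Local Notation ox := (@prod_obj R).

Definition tens_prob (X X' Y Y' : S) (K : Arr X (P X')) (L : Arr Y (P Y'))
    (a : prod_space X Y) : Prob (prod_space X' Y') :=
  exist _ (prod_law (sval (sval K a.1)) (sval (sval L a.2)))
    (is_prob_prod (proj2_sig (sval K a.1)) (proj2_sig (sval L a.2))).

Lemma tens_prob_smooth (X X' Y Y' : S) (K : Arr X (P X')) (L : Arr Y (P Y')) :
  is_smooth (tens_prob K L).
Proof.
move=> n p [p1 p2].
have [y py yE] := proj2_sig K _ _ p1; have [z pz zE] := proj2_sig L _ _ p2.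
have m1 := @measurable_theta1 R; have m2 := @measurable_theta2 R.
pose A (w : Om) := thetaV (theta1 w) (theta1 (theta2 w)).
pose B (w : Om) := thetaV (theta1 w) (theta2 (theta2 w)).
have mA : measurable_fun setT A by apply: measurable_thetaV => //; exact: measurableT_comp.
have mB : measurable_fun setT B by apply: measurable_thetaV => //; exact: measurableT_comp.
exists (fun a => (y (a.1, A a.2), z (a.1, B a.2))).
  by split; [exact: (plots_reparam py mA)|exact: (plots_reparam pz mB)].
move=> t w /=.
have -> : sval (sval K (p (t, w)).1) = law U (fun w' => y (t, thetaV w w')) := yE t w.
have -> : sval (sval L (p (t, w)).2) = law U (fun w' => z (t, thetaV w w')) := zE t w.
have mV := measurable_thetaV2 w.
rewrite prod_law_unif; [|exact: (plots_samples t py mV)|exact: (plots_samples t pz mV)].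
apply: (congr1 (@law R U (prod_space X' Y'))); apply/funext => w'.
by rewrite /indep_pair /A /B theta1V theta2V.
Qed.

Definition tens_arr (X X' Y Y' : S) (K : @Arr Kl X X') (L : @Arr Kl Y Y') :
    @Arr Kl (ox X Y) (ox X' Y') :=
  exist (@is_smooth R (ox X Y) (P (ox X' Y'))) (tens_prob K L)
    (@tens_prob_smooth X X' Y Y' K L).

Lemma tens_pure (X X' Y Y' : S) (f : Arr X X') (g : Arr Y Y') :
  tens_arr (pure f) (pure g) = pure (prod_arr f g).
Proof. by apply: kl_eq => -[x y] /=; exact: prod_law_dirac. Qed.

Lemma tens_arr_id (X Y : S) : tens_arr (@idm Kl X) (@idm Kl Y) = @idm Kl (ox X Y).
Proof.
rewrite !kl_idE tens_pure; congr (pure _).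
by apply: smap_eq; apply/funext => -[x y].
Qed.

(** Four independent streams, regrouped by swapping the middle two. *)
Definition interchange_seq V (s : nat -> V) : nat -> V :=
  interleave (interleave (evens (evens s)) (evens (odds s)))
             (interleave (odds (evens s)) (odds (odds s))).

Lemma interchange_seqK V (s : nat -> V) : interchange_seq (interchange_seq s) = s.
Proof.
by rewrite /interchange_seq !(evens_interleave, odds_interleave) !interleaveK.
Qed.

Lemma law_interchange_seq (X : plot_space R) (x : Om -> X) : samples x ->
  law U (fun w => x (interchange_seq w)) = law U x.
Proof.
apply: (law_rearrange (r := interchange_seq) (s' := interchange_seq id)).
  by move=> V V' f s; rewrite /interchange_seq !comp_interleave.
exact: interchange_seqK.
Qed.

Lemma measurable_interchange_seq :
  measurable_fun setT (@interchange_seq {i01 R} : Om -> Om).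
Proof.
have m1 := @measurable_theta1 R; have m2 := @measurable_theta2 R.
apply: (measurable_thetaV
  (f := fun w => thetaV (theta1 (theta1 w)) (theta1 (theta2 w)))
  (g := fun w => thetaV (theta2 (theta1 w)) (theta2 (theta2 w))));
  by apply: measurable_thetaV; exact: measurableT_comp.
Qed.

(** On the left each factor composes with its own two streams; on the right the
    first morphisms share one half of the randomness and the second ones the
    other half. *)
Lemma tens_arr_cmp (X X' X'' Y Y' Y'' : S) (g : @Arr Kl X' X'') (f : @Arr Kl X X')
    (k : @Arr Kl Y' Y'') (h : @Arr Kl Y Y') :
  tens_arr (g ∘ f) (k ∘ h) = tens_arr g k ∘ tens_arr f h.
Proof.
apply: kl_eq => -[x y].
have [a sa fa] := Prob_unif (sval f x); have [b sb hb] := Prob_unif (sval h y).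
have [G sG gG] := kl_cond g sa; have [H sH kH] := kl_cond k sb.
have sGH := samples_indep_pair sG sH.
transitivity (prod_law (sval (sval (g ∘ f) x)) (sval (sval (k ∘ h) y))) => //.
rewrite (kl_cmp_law sa sG fa gG) (kl_cmp_law sb sH hb kH) prod_law_unif//.
rewrite -law_interchange_seq//; apply/esym.
apply: (@kl_cmp_law R (ox X Y) (ox X' Y') (ox X'' Y'') (tens_arr g k)
  (tens_arr f h) (x, y) (indep_pair a b)
  (fun w => indep_pair G H (interchange_seq w)) (samples_indep_pair sa sb)).
- exact: (@samples_reparam R (ox X'' Y'') _ _ sGH measurable_interchange_seq).
- by rewrite /= fa hb prod_law_unif.
- move=> w; rewrite /= (gG (theta1 w)) (kH (theta2 w)) prod_law_unif.
  + apply: (congr1 (@law R U (prod_space X'' Y''))); apply/funext => w'.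
    have e1 z : theta1 (interchange_seq z)
        = thetaV (theta1 (theta1 z)) (theta1 (theta2 z)) by exact: evens_interleave.
    have e2 z : theta2 (interchange_seq z)
        = thetaV (theta2 (theta1 z)) (theta2 (theta2 z)) by exact: odds_interleave.
    by rewrite /indep_pair e1 e2 !theta1V !theta2V.
  + exact: (samples_reparam sG (measurable_thetaV2 _)).
  + exact: (samples_reparam sH (measurable_thetaV2 _)).
Qed.

Lemma assoc_arr_nat (X X' Y Y' Z Z' : S) (f : @Arr Kl X X') (g : @Arr Kl Y Y')
    (h : @Arr Kl Z Z') :
  pure (assoc_map X' Y' Z') ∘ tens_arr (tens_arr f g) h
  = tens_arr f (tens_arr g h) ∘ pure (assoc_map X Y Z).
Proof.
apply: kl_eq => -[[x y] z]; rewrite pure_post pure_pre /=.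
have [a sa ->] := Prob_unif (sval f x); have [b sb ->] := Prob_unif (sval g y).
have [c sc ->] := Prob_unif (sval h z).
have sab := samples_indep_pair sa sb; have sbc := samples_indep_pair sb sc.
have sm := proj2_sig (assoc_map X' Y' Z').
rewrite (prod_law_unif sa sb) (prod_law_unif sb sc).
rewrite [X in pushm _ X](@prod_law_unif R (ox X' Y') Z' _ _ sab sc).
rewrite [RHS](@prod_law_unif R X' (ox Y' Z') _ _ sa sbc) [LHS](pushm_law _ _ sm).
have sabc := @samples_indep_pair R (ox X' Y') Z' _ _ sab sc.
rewrite -(@law_assoc_seq R (ox X' (ox Y' Z')) _ (samples_map sm sabc)).
apply: (congr1 (@law R U (ox X' (ox Y' Z')))); apply/funext => w.
rewrite /indep_pair /=.
have e1 : theta1 (assoc_seq w) = thetaV (theta1 w) (theta1 (theta2 w)).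
  exact: evens_interleave.
have e2 : theta2 (assoc_seq w) = theta2 (theta2 w) by exact: odds_interleave.
by rewrite e1 e2 theta1V theta2V.
Qed.

Lemma swap_arr_nat (X X' Y Y' : S) (f : @Arr Kl X X') (g : @Arr Kl Y Y') :
  pure (swap_map X' Y') ∘ tens_arr f g = tens_arr g f ∘ pure (swap_map X Y).
Proof.
apply: kl_eq => -[x y]; rewrite pure_post pure_pre /=.
have [a sa ->] := Prob_unif (sval f x); have [b sb ->] := Prob_unif (sval g y).
rewrite (prod_law_unif sa sb) (prod_law_unif sb sa).
exact/esym/(law_indep_swap sa sb).
Qed.

Lemma lunit_arr_nat (X X' : S) (f : @Arr Kl X X') :
  pure (proj2_map one X') ∘ tens_arr (@idm Kl one) f = f ∘ pure (proj2_map one X).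
Proof.
apply: kl_eq => -[[] x]; rewrite pure_post pure_pre /=.
have [a sa ->] := Prob_unif (sval f x).
have sc := @samples_cst R one tt.
rewrite -(law_cst _ U) (prod_law_unif sc sa) pushm_law.
  exact: law_theta2.
exact: (proj2_sig (proj2_map one X')).
Qed.

Lemma runit_arr_nat (X X' : S) (f : @Arr Kl X X') :
  pure (proj1_map X' one) ∘ tens_arr f (@idm Kl one) = f ∘ pure (proj1_map X one).
Proof.
apply: kl_eq => -[x []]; rewrite pure_post pure_pre /=.
have [a sa ->] := Prob_unif (sval f x).
have sc := @samples_cst R one tt.
rewrite -(law_cst _ U) (prod_law_unif sa sc) pushm_law.
  exact: law_theta1.
exact: (proj2_sig (proj1_map X' one)).
Qed.

Lemma pure_eq (X Y : S) (f g : Arr X Y) :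
  (forall x, sval f x = sval g x) -> pure f = pure g.
Proof. by move=> fg; congr (pure _); apply: smap_eq; apply/funext. Qed.

Lemma pure_cmp (X Y Z : S) (g : Arr Y Z) (f : Arr X Y) :
  @cmp Kl X Y Z (pure g) (pure f) = pure (g ∘ f).
Proof. by rewrite fmap_cmp. Qed.

Definition kl_smc : @sym_monoidal Kl ox one.
Proof.
refine (@SymMonoidal Kl ox one tens_arr
  (fun X Y Z => pure (assoc_map X Y Z)) (fun X Y Z => pure (assocV_map X Y Z))
  (fun X => pure (proj2_map one X)) (fun X => pure (lunitV_map X))
  (fun X => pure (proj1_map X one)) (fun X => pure (runitV_map X))
  (fun X Y => pure (swap_map X Y)) tens_arr_id tens_arr_cmp
  _ _ _ _ _ _ assoc_arr_nat lunit_arr_nat runit_arr_nat swap_arr_nat _ _ _ _);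
  move=> *; cbv beta; rewrite ?kl_idE ?tens_pure ?pure_cmp; apply: pure_eq => x.
all: move: x.
- by case=> [[? ?] ?].
- by case=> [? [? ?]].
- by case=> [[] ?].
- by [].
- by case=> [? []].
- by [].
- by case=> [[[? ?] ?] ?].
- by case=> [[? []] ?].
- by case=> [[? ?] ?].
- by case=> [? ?].
Defined.

Lemma kl_to_one_unique (X : S) (K L : @Arr Kl X one) : K = L.
Proof.
apply: kl_eq => x.
have [a _ ->] := Prob_unif (sval K x); have [b _ ->] := Prob_unif (sval L x).
by congr (law U _); apply/funext => w; case: (a w) (b w) => -[].
Qed.

Definition kl_markov : @markov_category Kl ox one.
Proof.
refine (@Markov Kl ox one kl_smc (fun X => pure (diag X)) (fun X => pure (bang X))
  _ _ _ _ _ _ _ _ (fun X Y K => kl_to_one_unique _ _));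
  move=> *; rewrite /Defs.interchange;
  cbn [kl_smc tens assoc assocV lunit runit swap lunitV];
  rewrite ?kl_idE ?(tens_pure, pure_cmp); apply: pure_eq => //.
all: by case.
Defined.

Lemma kl_terminal : @terminal Kl one.
Proof. by move=> X; exists (pure (bang X)); split=> // K _; exact: kl_to_one_unique. Qed.

Lemma pure_deterministic (X Y : S) (f : Arr X Y) : deterministic kl_markov (pure f).
Proof.
rewrite /deterministic; cbn [kl_markov kl_smc copy tens markov_smc].
by rewrite tens_pure !pure_cmp; exact: pure_eq.
Qed.

End markov.

(** * Copying a random point is not drawing two independent ones *)

Section zero_one.
Context (R : realType).
Local Notation Om := (Omega R).
Local Notation U := (unif R).
Implicit Types X : sss R.

Lemma unif_halves (B C : set Om) : measurable B -> measurable C ->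
  U [set w | B (theta1 w) /\ C (theta2 w)] = (U B * U C)%E.
Proof.
move=> mB mC; have mA : measurable [set w | B (theta1 w) /\ C (theta2 w)].
  apply: measurableI.
    exact: (measurable_um_preimage (@measurable_theta1 R) mB).
  exact: (measurable_um_preimage (@measurable_theta2 R) mC).
rewrite -(unif_fubini mA) (eq_integral (fun w => (\1_B w)%:E * U C)%E).
  rewrite ge0_integralZr//; last exact/measurable_EFinP/measurable_indic.
  by rewrite integral_indic// setIT.
move=> w _; rewrite indicE; have [Bw|nBw] := pselect (B w).
  rewrite mem_set// mul1e; congr (U _); apply/seteqP; split=> w' /=.
    by rewrite /section /= theta1V theta2V => -[].
  by rewrite /section /= theta1V theta2V.
rewrite memNset// mul0e -(measure0 U); congr (U _); apply/seteqP; split=> // w'.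
by rewrite /section /= theta1V => -[].
Qed.

(** Both laws are evaluated on the square [A * A]. *)
Lemma diag_prod_idem X (x : Om -> X) (A : set X) : samples x ->
  pushm (sval (diag X)) (law U x) = prod_law (law U x) (law U x) ->
  induced_sigma A -> (U (x @^-1` A) = U (x @^-1` A) * U (x @^-1` A))%E.
Proof.
move=> sx; rewrite (prod_law_unif sx sx) (pushm_law _ _ (proj2_sig (diag X))).
move=> e mA; pose AA : set (prod_space X X) := [set p | A p.1 /\ A p.2].
have mAA : induced_sigma AA.
  by move=> z [s1 s2]; apply: measurableI; [exact: (mA _ s1)|exact: (mA _ s2)].
have := congr1 (@^~ AA) e; rewrite !lawE//= => e'.
rewrite -unif_halves; [|exact: mA|exact: mA].
by rewrite -[RHS]e'; congr (U _); apply/seteqP; split=> w //= -[].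
Qed.

Lemma idem_zero_one (m : \bar R) :
  m \is a fin_num -> (m = m * m)%E -> m = 0%E \/ m = 1%E.
Proof.
case: m => // r _ [] /eqP; rewrite -subr_eq0 -{1}[r]mulr1 -mulrBr mulf_eq0.
by rewrite subr_eq0 => /orP[/eqP->|/eqP<-]; [left|right].
Qed.

Lemma null_bigcup (F : (set Om)^nat) : (forall n, measurable (F n)) ->
  (forall n, U (F n) = 0%E) -> U (\bigcup_n F n) = 0%E.
Proof.
move=> mF F0; apply: measure_negligible; first exact: bigcupT_measurable.
apply: negligible_bigcup => n; exists (F n).
by split; [exact: mF|exact: F0|exact: subset_refl].
Qed.

(** Take for [c] the supremum of the levels where the distribution function
    vanishes: then [r < c] and [r > c] are countable unions of null events. *)
Lemma zero_one_cst (r : Om -> R) : measurable_fun setT r ->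
  (forall q, U [set w | r w <= q] = 0%E \/ U [set w | r w <= q] = 1%E) ->
  exists c, U [set w | r w != c] = 0%E.
Proof.
move=> mr r01; pose A q := [set w | r w <= q].
have mA q : measurable (A q).
  rewrite (_ : A q = r @^-1` `]-oo, q]); last by apply/seteqP; split=> w; rewrite /= in_itv.
  by rewrite -[X in measurable X]setTI; exact: mr.
have Ale q q' : q <= q' -> (U (A q) <= U (A q'))%E.
  by move=> qq'; apply: le_measure; rewrite ?inE// => w /= /le_trans; exact.
have A1C q : U (A q) = 1%E -> U (~` A q) = 0%E.
  by move=> Aq; rewrite probability_setC// [X in (_ - X)%E]Aq subee.
pose D := [set q | U (A q) = 0%E].
have [q1 Aq1] : exists q, U (A q) = 1%E.
  apply/not_existsP => nA; have A0 q : U (A q) = 0%E by case: (r01 q) => // /nA.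
  have := null_bigcup (fun n => mA n%:R) (fun n => A0 n%:R).
  rewrite (_ : \bigcup_n _ = setT) ?probability_setT; first by move/eqP; rewrite onee_eq0.
  by apply/seteqP; split=> // w _; exists (Num.bound (r w)) => //=; rewrite /A/= ltW// unstable.ltr_bound.
have [q0 Aq0] : exists q, U (A q) = 0%E.
  apply/not_existsP => nA; have A0 q : U (~` A q) = 0%E by apply: A1C; case: (r01 q) => // /nA.
  have := null_bigcup (fun n => measurableC (mA (- n%:R))) (fun n => A0 (- n%:R)).
  rewrite (_ : \bigcup_n _ = setT) ?probability_setT; first by move/eqP; rewrite onee_eq0.
  apply/seteqP; split=> // w _; exists (Num.bound (r w)) => //=; rewrite /A/=.
  by apply/negP; rewrite -ltNge ltrNl unstable.ltrNbound.
have Dub : has_ubound D.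
  exists q1 => q Dq; rewrite leNgt; apply/negP => /ltW/Ale.
  by rewrite Aq1 [X in (_ <= X)%E]Dq lee_fin ler10.
have Dsup : has_sup D by split => //; exists q0.
pose c := sup D; exists c.
have mB q : measurable [set w | r w != q].
  rewrite (_ : [set w | r w != q] = r @^-1` [set~ q]).
    rewrite -[X in measurable X]setTI; apply: mr => //.
    exact: measurableC.
  by apply/seteqP; split=> w /= /eqP.
have below n : U (A (c - n.+1%:R^-1)) = 0%E.
  have [q Dq cq] : exists2 q, D q & c - n.+1%:R^-1 < q by apply: sup_adherent.
  apply/eqP; rewrite eq_le measure_ge0 andbT -[X in (_ <= X)%E]Dq.
  exact/Ale/ltW.
have above n : U (~` A (c + n.+1%:R^-1)) = 0%E.
  apply: A1C; case: (r01 (c + n.+1%:R^-1)) => // Dq.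
  have := ub_le_sup Dub Dq; rewrite -/c gerDl leNgt invr_gt0 ltr0n.
  by [].
pose N n := A (c - n.+1%:R^-1) `|` ~` A (c + n.+1%:R^-1).
have mN n : measurable (N n) by apply: measurableU => //; exact: measurableC.
have N0 n : U (N n) = 0%E.
  apply/eqP; rewrite eq_le measure_ge0 andbT (le_trans (measureU2 _ _ _))//.
    exact: measurableC.
  by rewrite [X in (X + _)%E]below [X in (_ + X)%E]above adde0.
apply/eqP; rewrite eq_le measure_ge0 andbT -(null_bigcup mN N0).
apply: le_measure; rewrite ?inE//; first exact: bigcupT_measurable.
move=> w /=; rewrite neq_lt => /orP[/ltr_add_invr[n h]|/ltr_add_invr[n h]]; exists n => //.
  by left; rewrite /A /= lerBrDr ltW.
by right; rewrite /A /=; apply/negP; rewrite -ltNge.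
Qed.

End zero_one.

Section real_line.
Context (R : realType).
Local Notation Om := (Omega R).
Local Notation U := (unif R).
Local Notation P := (@prob_obj R).
Local Notation T := (@prob_monad R).
Local Notation Kl := (kleisli T).

Definition real_line : SSScat R := SSS (@euclidean1_sss R).

Lemma measurable_real_sample (x : Om -> real_line) : samples x ->
  measurable_fun setT (fun w => x w 0 0).
Proof.
by move=> [_ /(_ 0) mx]; exact: (measurableT_comp (@measurable_rV_coord R 1 0) mx).
Qed.

Lemma induced_sigma_le (q : R) :
  @induced_sigma R real_line [set z : 'rV[R]_1 | z 0 0 <= q].
Proof.
move=> x /measurable_real_sample mx.
have := mx measurableT _ (measurable_itv `]-oo, q]); rewrite setTI.
by congr (measurable _); apply/seteqP; split=> w; rewrite /= in_itv.
Qed.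

Lemma zero_one_dirac (x : Om -> real_line) : samples x ->
  (forall A, induced_sigma A -> U (x @^-1` A) = 0%E \/ U (x @^-1` A) = 1%E) ->
  exists c : real_line, law U x = dirac_law c.
Proof.
move=> sx x01.
have [c xc] := zero_one_cst (measurable_real_sample sx)
  (fun q => x01 _ (induced_sigma_le q)).
exists (const_mx c : 'rV[R]_1); apply/funext => A.
rewrite /law /dirac_law !patchE; case: ifPn => // /set_mem mA.
have off (B : set Om) : measurable B -> (forall w, B w -> x w != const_mx c :> 'rV_1) ->
    U B = 0%E.
  move=> mB Bc; apply: measure_negligible => //; exists [set w | x w 0 0 != c].
  split=> //.
    have mr := measurable_real_sample sx.
    rewrite (_ : [set _ | _] = (fun w => x w 0 0) @^-1` [set~ c]).
      rewrite -[X in measurable X]setTI; apply: mr => //; exact: measurableC.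
    by apply/seteqP; split=> w /= /eqP.
  move=> w /Bc /=; apply: contra_neq => xwc; apply/rowP => j.
  by rewrite ord1 xwc mxE.
rewrite indicE; have [Ac|nAc] := pselect (A (const_mx c)).
  rewrite mem_set//; have : U (~` (x @^-1` A)) = 0%E.
    apply: off; first by apply: measurableC; exact: mA.
    by move=> w nA; apply: contra_notN nA => /eqP xw; rewrite /= xw.
  rewrite probability_setC; last exact: mA.
  have fA : U (x @^-1` A) \is a fin_num by rewrite fin_num_measure//; exact: mA.
  by rewrite -(fineK fA) -EFinB => -[] /eqP; rewrite subr_eq0 => /eqP <-.
rewrite memNset//; apply: off; first exact: mA.
by move=> w Aw; apply: contra_notN nAc => /eqP <-.
Qed.

Lemma diag_not_prod (mu : P real_line) :
  (forall x : real_line, sval mu <> dirac_law x) ->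
  pushm (sval (diag real_line)) (sval mu) <> prod_law (sval mu) (sval mu).
Proof.
have [x sx ->] := Prob_unif mu => nd e; have [A mA|c /nd//] := zero_one_dirac sx.
apply: idem_zero_one; last exact: diag_prod_idem.
by rewrite fin_num_measure//; exact: mA.
Qed.

(** The uniform law gives probability one half to [z <= 1/2]. *)
Lemma exists_not_dirac : exists mu : P real_line,
  forall x : real_line, sval mu <> dirac_law x.
Proof.
pose x (w : Om) : real_line := const_mx (w 0%N)%:num : 'rV[R]_1.
have sx : samples x.
  split=> [w k|t]; first exact: (@Ck_cst R 0 1 k (x w)).
  apply: measurable_to_rV1 => /=; rewrite /x.
  under eq_fun do rewrite mxE.
  exact: measurable_coord_um.
exists (sample_prob sx) => c /= /(congr1 (@^~ [set z : 'rV[R]_1 | z 0 0 <= 2^-1])).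
have mA := induced_sigma_le 2^-1.
rewrite lawE// /dirac_law patchE mem_set// indicE.
have -> : U (x @^-1` [set z : 'rV[R]_1 | z 0 0 <= 2^-1]) = (2^-1)%:E.
  have := @unifP R 1%N (fun=> `]-oo, 2^-1]%classic).
  rewrite big_ord1 uniform01_restrict// (_ : _ `&` _ = `]0, 2^-1]%classic).
    rewrite uniform01_itv; last by apply/andP; split; lra.
    move=> <- //; congr (U _); apply/seteqP; split => w /=; rewrite /x mxE.
      by move=> h [|//] _; rewrite /= in_itv.
    by move=> /(_ 0%N isT); rewrite in_itv.
  by apply/seteqP; split=> r; rewrite /= !in_itv/=;
    [move=> [h1 /andP[h2 h3]]|move=> /andP[h1 h2]]; rewrite ?h1 ?h2//; split=> //; lra.
case: (_ \in _) => -[] h; first by have h1 : (2^-1 : R) = 1 := h; lra.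
by have h0 : (2^-1 : R) = 0 := h; lra.
Qed.

Lemma not_copy_natural : ~ copy_natural (@kl_markov R).
Proof.
have [mu nd] := exists_not_dirac.
pose K : @Arr Kl (one_obj R) real_line :=
  exist (@is_smooth R (one_obj R) (P real_line)) (fun=> mu)
    (fun n _ _ => (Prob_sss real_line).1 n mu).
move=> /(_ _ _ K); rewrite /deterministic.
cbn [kl_markov kl_smc copy tens markov_smc].
move=> /(congr1 (fun L : Arr (one_obj R) (P (prod_obj real_line real_line)) =>
  sval (sval L tt))).
rewrite pure_post pure_pre /=; exact: diag_not_prod.
Qed.

End real_line.

Theorem theorem6p18 (R : realType) :
  exists (HP : forall X : sss R, sample_smooth (Prob X))
         (HR : sample_smooth (euclidean R 1)),
  let P : SSScat R -> SSScat R := fun X => SSS (HP X) in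
  let RR : SSScat R := SSS HR in
  exists T : monad P,
  [/\ forall (X Y : SSScat R) (f : Arr X Y) (nu : P X),
        sval (sval (tmap T f) nu) = pushm (sval f) (sval nu),
      forall (X : SSScat R) (x : X), sval (sval (eta T X) x) = dirac_law x
    & forall (X : SSScat R) (Gamma : P (P X)),
        sval (sval (mult T X) Gamma) = barycenter (sval Gamma)] /\
  exists M : @markov_category (kleisli T) (@prod_obj R) (one_obj R),
  [/\ [/\ forall (X Y Z W : SSScat R)
            (K : @Arr (kleisli T) X Y) (L : @Arr (kleisli T) Z W) (x : X) (z : Z),
            sval (sval (tens M K L) (x, z))
            = prod_law (sval (sval K x)) (sval (sval L z)),
          forall X Y Z : SSScat R,
            assoc M X Y Z = funmap (kl_incl T) (assoc_map X Y Z),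
          forall X : SSScat R,
            lunit M X = funmap (kl_incl T) (proj2_map (one_obj R) X),
          forall X : SSScat R,
            runit M X = funmap (kl_incl T) (proj1_map X (one_obj R))
        & forall X Y : SSScat R,
            swap M X Y = funmap (kl_incl T) (swap_map X Y)],
      (forall X : SSScat R, copy M X = funmap (kl_incl T) (diag X)) /\
      (forall X : SSScat R, del M X = funmap (kl_incl T) (bang X)),
      @terminal (kleisli T) (one_obj R),
      [/\ ~ cartesian M,
          ~ copy_natural M
        & forall mu : P RR, (forall x : RR, sval mu <> dirac_law x) ->
            sval (sval (tmap T (diag RR)) mu) <> prod_law (sval mu) (sval mu)]
    & forall (X Y : SSScat R) (f : Arr X Y),
        deterministic M (funmap (kl_incl T) f)].
Proof.
exists (@Prob_sss R), (@euclidean1_sss R) => P RR; exists (@prob_monad R); split=> //.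
exists (@kl_markov R); split=> //.
- exact: kl_terminal.
- split; [|exact: not_copy_natural|exact: diag_not_prod].
  by move=> /cartesian_copy_natural; exact: not_copy_natural.
- exact: pure_deterministic.
Qed.
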